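(* Let $(\mathcal{G},X,T)$ be a minimal decomposed graph of groups and let $\Gamma=\pi_1(\mathcal{G},X)$ be its fundamental group, with centre $Z(\Gamma)$. Then one of the following holds. (A) $X$ has a unique vertex $s$ and a unique non-oriented edge $\{a,-a\}$ (with $a\in\mathcal{A}_X^+$). In this case $\Gamma$ is the HNN extension of $G_s$ along $\varphi_a:G_a^-\to G_a^+$ with stable letter $t=t_a$ ($t^{-1}ht=\varphi_a(h)$ for $h\in G_a^-$), and: - if $G_a^-$ or $G_a^+$ is a proper subgroup of $G_s$, then $Z(\Gamma)=Z(G_s)\cap \mathrm{Fix}\,a$; - if $G_a^-=G_a^+=G_s$ and $\varphi_a$ has infinite order in $\mathrm{Out}(G_s)$, then $Z(\Gamma)=Z(G_s)\cap\mathrm{Fix}\,a$; - if $G_a^-=G_a^+=G_s$ and $\varphi_a$ has finite order $n$ in $\mathrm{Out}(G_s)$, then for any $g_0\in G_s$ such that $\varphi_a^n(g)=g_0gg_0^{-1}$ for all $g\in G_s$, one has $Z(\Gamma)=\bigcup_{p\in\mathbb{Z}}t^{pn}\cdot\big(\mathrm{Fix}\,a\cap g_0^pZ(G_s)\big)$. (B) Otherwise, $$Z(\Gamma)=\Big(\bigcap_{s\in\mathcal{S}_X}Z(G_s)\Big)\cap\Big(\bigcap_{a\in\mathcal{A}_X\setminus\mathcal{A}_T}\mathrm{Fix}\,a\Big),$$ where an intersection over an empty set of edges imposes no condition.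
   Context: A finite graph $X$ consists of finite sets $\mathcal{A}_X$ (edges) and $\mathcal{S}_X$ (vertices), a fixed-point-free involution $a\mapsto -a$ of $\mathcal{A}_X$, and maps $\mathrm{o},\mathrm{e}:\mathcal{A}_X\to\mathcal{S}_X$ (origin, end) with $\mathrm{e}(a)=\mathrm{o}(-a)$. A non-oriented edge is a pair $\{a,-a\}$. An orientation is a subset $\mathcal{A}_X^+\subset\mathcal{A}_X$ containing exactly one of $a,-a$ for each $a$. A graph of groups $(\mathcal{G},X)$ is a finite connected oriented graph $X$ with vertex groups $G_s$ ($s\in\mathcal{S}_X$), edge groups $G_a$ ($a\in\mathcal{A}_X^+$), and monomorphisms $f_a:G_a\to G_{\mathrm{o}(a)}$, $f_{-a}:G_a\to G_{\mathrm{e}(a)}$ for $a\in\mathcal{A}_X^+$. A decomposed graph of groups $(\mathcal{G},X,T)$ is a graph of groups together with a maximal tree $T$ of $X$. Its fundamental group $\pi_1(\mathcal{G},X)$ is the quotient of the free product of all $G_s$ and the free group on $\{t_a: a\in\mathcal{A}_X\}$ by the relations $f_a(h)=t_af_{-a}(h)t_a^{-1}$ ($a\in\mathcal{A}_X^+$, $h\in G_a$), $t_{-a}=t_a^{-1}$ ($a\in\mathcal{A}_X$), $t_a=1$ ($a\in\mathcal{A}_T$). Each $G_s$ embeds naturally in $\pi_1(\mathcal{G},X)$ and is identified with its image. For $a\in\mathcal{A}_X^+$, put $G_a^-=f_a(G_a)\subset G_{\mathrm{o}(a)}$, $G_a^+=f_{-a}(G_a)\subset G_{\mathrm{e}(a)}$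 (as subgroups of $\pi_1(\mathcal{G},X)$), and $\varphi_a=f_{-a}\circ f_a^{-1}:G_a^-\to G_a^+$; also $G_{-a}^{\mp}=G_a^{\pm}$ and $\varphi_{-a}=\varphi_a^{-1}$. In $\pi_1(\mathcal{G},X)$, $h=t_a\varphi_a(h)t_a^{-1}$ for $h\in G_a^-$. If $a\in\mathcal{A}_T$ then $G_a^-=G_a^+$, denoted $G_a$, and $\varphi_a$ is the identity. $(\mathcal{G},X,T)$ is minimal if for every edge $a\in\mathcal{A}_T^+$, $G_a$ is a proper subgroup of both $G_{\mathrm{o}(a)}$ and $G_{\mathrm{e}(a)}$. For an edge $a\in\mathcal{A}_X\setminus\mathcal{A}_T$, $\mathrm{Fix}\,a$ is the subgroup of $G_a^-\cap G_a^+\subset\pi_1(\mathcal{G},X)$ of elements fixed by $\varphi_a$ (so $\mathrm{Fix}\,a=\mathrm{Fix}(-a)$). $Z(H)$ denotes the centre of $H$. *)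

(* Defs.v *)
From HB Require Import structures.
From mathcomp Require Import all_boot all_algebra.
From mathcomp Require Import boolp classical_sets.

Set Implicit Arguments.
Unset Strict Implicit.
Unset Printing Implicit Defensive.

Local Open Scope group_scope.
Local Open Scope classical_set_scope.
Local Open Scope quotient_scope.

Definition expgz (G : groupType) (x : G) (p : int) : G :=
  match p with Posz n => x ^+ n | Negz n => x ^- n.+1 end.

Definition center (G : groupType) : set G := [set z | forall x, commute z x].

Arguments center G : clear implicits.

Definition inner_map (G : groupType) (f : G -> G) : Prop :=
  exists g0, forall g, f g = g0 * g * g0^-1.

(* For an automorphism [f] of [G], the class of [f] in Out(G) = Aut(G)/Inn(G)
   has order [n], respectively infinite order. *)
Definition Out_order (G : groupType) (f : G -> G) (n : nat) : Prop :=
  [/\ (0 < n)%N, inner_map (iter n f) &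
      forall m, (0 < m < n)%N -> ~ inner_map (iter m f)].

Definition Out_order_infinite (G : groupType) (f : G -> G) : Prop :=
  forall n, (0 < n)%N -> ~ inner_map (iter n f).

(* The letter [(x, true)] stands for [x] and [(x, false)] for its inverse. *)
Definition word (X : Type) := seq (X * bool).

Section Presentation.
Variables (X : choiceType) (R : word X -> word X -> Prop).

Inductive pres_eq : word X -> word X -> Prop :=
| pres_refl u : pres_eq u u
| pres_sym u v : pres_eq u v -> pres_eq v u
| pres_trans u v w : pres_eq u v -> pres_eq v w -> pres_eq u w
| pres_cat u u' v v' : pres_eq u u' -> pres_eq v v' -> pres_eq (u ++ v) (u' ++ v')
| pres_cancel x b : pres_eq [:: (x, b); (x, ~~ b)] [::]
| pres_rel u v : R u v -> pres_eq u v.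

Definition pres_eqb : rel (word X) := fun u v => `[< pres_eq u v >].

Lemma pres_eqb_refl : reflexive pres_eqb.
Proof. by move=> u; apply/asboolP; exact: pres_refl. Qed.

Lemma pres_eqb_sym : symmetric pres_eqb.
Proof.
by move=> u v; apply/idP/idP => /asboolP h; apply/asboolP; exact: pres_sym.
Qed.

Lemma pres_eqb_trans : transitive pres_eqb.
Proof.
by move=> v u w /asboolP h /asboolP k; apply/asboolP; exact: pres_trans h k.
Qed.

Canonical pres_equiv :=
  EquivRel pres_eqb pres_eqb_refl pres_eqb_sym pres_eqb_trans.

Definition presented := {eq_quot pres_equiv}.
HB.instance Definition _ := Choice.on presented.

Definition wclass (u : word X) : presented := \pi_presented u.

Lemma wclassP u v : wclass u = wclass v <-> pres_eq u v.
Proof.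
split; first by move=> /eqmodP /asboolP.
by move=> h; apply/eqmodP/asboolP.
Qed.

Lemma repr_wclass u : pres_eq (repr (wclass u)) u.
Proof. by apply/wclassP; rewrite /wclass reprK. Qed.

Lemma wclassK (x : presented) : wclass (repr x) = x.
Proof. by rewrite /wclass reprK. Qed.

Definition winv (u : word X) : word X := rev [seq (l.1, ~~ l.2) | l <- u].

Lemma winv_l u : pres_eq (winv u ++ u) [::].
Proof.
elim: u => [|[x b] u ih]; first exact: pres_refl.
rewrite /winv /= rev_cons -cats1 -catA -[_ :: u]/([:: (x, b)] ++ u).
apply: pres_trans ih; apply: pres_cat; first exact: pres_refl.
rewrite catA -[X in pres_eq _ X]cat0s.
apply: pres_cat; last exact: pres_refl.
by have := pres_cancel x (~~ b); rewrite negbK.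
Qed.

Lemma winv_r u : pres_eq (u ++ winv u) [::].
Proof.
elim/last_ind: u => [|u [x b] ih]; first exact: pres_refl.
rewrite /winv map_rcons rev_rcons -cats1 -catA.
apply: pres_trans ih; apply: pres_cat; first exact: pres_refl.
rewrite -[X in pres_eq _ X]cat0s -[_ :: rev _]cat1s catA.
by apply: pres_cat; [exact: pres_cancel | exact: pres_refl].
Qed.

Definition pres_mul (x y : presented) : presented := wclass (repr x ++ repr y).
Definition pres_one : presented := wclass [::].
Definition pres_inv (x : presented) : presented := wclass (winv (repr x)).

Lemma pres_mulA : associative pres_mul.
Proof.
move=> x y z; apply/wclassP.
apply: (@pres_trans _ (repr x ++ (repr y ++ repr z))).
  by apply: pres_cat; [exact: pres_refl | exact: repr_wclass].
rewrite catA; apply: pres_cat; last exact: pres_refl.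
by apply: pres_sym; exact: repr_wclass.
Qed.

Lemma pres_mul1g : left_id pres_one pres_mul.
Proof.
move=> x; rewrite -[RHS]wclassK; apply/wclassP; rewrite -[X in pres_eq _ X]cat0s.
by apply: pres_cat; [exact: repr_wclass | exact: pres_refl].
Qed.

Lemma pres_mulg1 : right_id pres_one pres_mul.
Proof.
move=> x; rewrite -[RHS]wclassK; apply/wclassP; rewrite -[X in pres_eq _ X]cats0.
by apply: pres_cat; [exact: pres_refl | exact: repr_wclass].
Qed.

Lemma pres_mulVg : left_inverse pres_one pres_inv pres_mul.
Proof.
move=> x; apply/wclassP; apply: pres_trans (winv_l (repr x)).
by apply: pres_cat; [exact: repr_wclass | exact: pres_refl].
Qed.

Lemma pres_mulgV : right_inverse pres_one pres_inv pres_mul.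
Proof.
move=> x; apply/wclassP; apply: pres_trans (winv_r (repr x)).
by apply: pres_cat; [exact: pres_refl | exact: repr_wclass].
Qed.

HB.instance Definition _ := isGroup.Build presented
  pres_mulA pres_mul1g pres_mulg1 pres_mulVg pres_mulgV.

Definition gen (x : X) : presented := wclass [:: (x, true)].

End Presentation.

(* The isomorphism between two subgroups of [G] is given by its graph [phi];
   the stable letter satisfies t^-1 h t = phi(h). *)
Section HNN.
Variables (G : groupType) (phi : G -> G -> Prop).

Inductive HNN_rel : word (G + unit) -> word (G + unit) -> Prop :=
| HNN_rel_mul (g h : G) :
    HNN_rel [:: (inl (g * h), true)] [:: (inl g, true); (inl h, true)]
| HNN_rel_stable (h h' : G) : phi h h' ->
    HNN_rel [:: (inr tt, false); (inl h, true); (inr tt, true)]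
            [:: (inl h', true)].

Definition HNN := presented HNN_rel.
HB.instance Definition _ := Group.on HNN.

Definition HNN_base (g : G) : HNN := gen HNN_rel (inl g).
Definition HNN_stable : HNN := gen HNN_rel (inr tt).

End HNN.

Record finGraph := FinGraph {
  vertex : finType;
  edge : finType;
  eopp : edge -> edge;
  origin : edge -> vertex;
  terminus : edge -> vertex;
  eoppK : involutive eopp;
  eopp_neq : forall a, eopp a != a;
  terminusE : forall a, terminus a = origin (eopp a)
}.

Record subgraph (X : finGraph) := Subgraph {
  sub_vertices : {set vertex X};
  sub_edges : {set edge X};
  sub_edges_opp : forall a, a \in sub_edges -> eopp a \in sub_edges;
  sub_edges_origin : forall a, a \in sub_edges -> origin a \in sub_vertices
}.

Definition adjacent (X : finGraph) (E : {set edge X}) : rel (vertex X) :=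
  fun u v => [exists a in E, (origin a == u) && (terminus a == v)].

Definition connected_graph (X : finGraph) (V : {set vertex X})
    (E : {set edge X}) : Prop :=
  V != finset.set0 /\ {in V &, forall u v, connect (adjacent E) u v}.

Definition circuit (X : finGraph) (p : seq (edge X)) : bool :=
  [&& p != [::],
      cycle [rel a b | (terminus a == origin b) && (b != eopp a)] p &
      uniq [seq origin a | a <- p]].

Definition tree (X : finGraph) (T : subgraph X) : Prop :=
  connected_graph (sub_vertices T) (sub_edges T) /\
  forall p, circuit p -> ~~ all (mem (sub_edges T)) p.

Definition maximal_tree (X : finGraph) (T : subgraph X) : Prop :=
  tree T /\ forall T' : subgraph X, tree T' ->
    sub_vertices T \subset sub_vertices T' ->
    sub_edges T \subset sub_edges T' ->
    sub_vertices T' = sub_vertices T /\ sub_edges T' = sub_edges T.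

(* For an edge [a] of the orientation, [mono_o a] and [mono_e a] are the
   monomorphisms usually written f_a and f_(-a). *)
Record graphOfGroups := GraphOfGroups {
  gg_graph :> finGraph;
  gg_connected : connected_graph (X := gg_graph) [set: _]%SET [set: _]%SET;
  orient : {set edge gg_graph};
  orientP : forall a, (a \in orient) (+) (eopp a \in orient);
  vgroup : vertex gg_graph -> groupType;
  egroup : {a | a \in orient} -> groupType;
  mono_o : forall a, {multiplicative egroup a -> vgroup (origin (val a))};
  mono_e : forall a, {multiplicative egroup a -> vgroup (terminus (val a))};
  mono_o_inj : forall a, injective (mono_o a);
  mono_e_inj : forall a, injective (mono_e a)
}.

Record decomposedGraphOfGroups := DecomposedGraphOfGroups {
  dgg_gg :> graphOfGroups;
  dgg_tree : subgraph dgg_gg;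
  dgg_treeP : maximal_tree dgg_tree
}.

Section FundamentalGroup.
Variable D : decomposedGraphOfGroups.

Notation T := (sub_edges (dgg_tree D)).

Definition velt := {s : vertex D & vgroup s}.
Definition in_v (s : vertex D) (g : vgroup s) : velt := Tagged (@vgroup D) g.
HB.instance Definition _ := Choice.on velt.

Definition pi1_gen : choiceType := (velt + edge D)%type.
Definition vletter (s : vertex D) (g : vgroup s) : pi1_gen * bool :=
  (inl (in_v g), true).
Definition tletter (a : edge D) : pi1_gen * bool := (inr a, true).
Definition tletterV (a : edge D) : pi1_gen * bool := (inr a, false).

Inductive pi1_rel : word pi1_gen -> word pi1_gen -> Prop :=
| pi1_rel_mul (s : vertex D) (g h : vgroup s) :
    pi1_rel [:: vletter (g * h)] [:: vletter g; vletter h]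
| pi1_rel_edge (a : {a | a \in orient D}) (h : egroup a) :
    pi1_rel [:: vletter (mono_o a h)]
            [:: tletter (val a); vletter (mono_e a h); tletterV (val a)]
| pi1_rel_opp (a : edge D) : pi1_rel [:: tletter (eopp a)] [:: tletterV a]
| pi1_rel_tree (a : edge D) : a \in T -> pi1_rel [:: tletter a] [::].

Definition pi1 := presented pi1_rel.
HB.instance Definition _ := Group.on pi1.

Definition stable (a : edge D) : pi1 := gen pi1_rel (inr a).
Definition velt_pi1 (u : velt) : pi1 := gen pi1_rel (inl u).
Definition vgroup_pi1 (s : vertex D) (g : vgroup s) : pi1 := velt_pi1 (in_v g).

(* G_s is identified with its image in the fundamental group; the natural map
   is injective, but this is a theorem, so the map is kept explicit. *)
Definition Gv (s : vertex D) : set pi1 := range (@vgroup_pi1 s).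

(* Graph of phi_a, for every edge [a], oriented positively or not:
   phi_a = f_(-a) o f_a^-1 and phi_(-a) = phi_a^-1 for [a] in the orientation. *)
Inductive phi : edge D -> velt -> velt -> Prop :=
| phi_pos (a : {a | a \in orient D}) (h : egroup a) :
    phi (val a) (in_v (mono_o a h)) (in_v (mono_e a h))
| phi_neg (a : {a | a \in orient D}) (h : egroup a) :
    phi (eopp (val a)) (in_v (mono_e a h)) (in_v (mono_o a h)).

(* G_a^- and G_a^+, as subsets of the fundamental group. *)
Definition Gminus (a : edge D) : set pi1 :=
  [set x | exists u v, phi a u v /\ velt_pi1 u = x].
Definition Gplus (a : edge D) : set pi1 :=
  [set x | exists u v, phi a u v /\ velt_pi1 v = x].

Definition Fix (a : edge D) : set pi1 :=
  [set x | exists u v, [/\ phi a u v, velt_pi1 u = x & velt_pi1 v = x]].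

(* phi_a as a map from G_s to itself; only meaningful when [s] is both ends of
   [a] and G_a^- is the whole of G_s (the value is 1 outside G_a^-). *)
Definition phi_map (s : vertex D) (a : edge D) (g : vgroup s) : vgroup s :=
  xget 1 [set g' | phi a (in_v g) (in_v g')].

Definition Zv (s : vertex D) : set pi1 := @vgroup_pi1 s @` center (vgroup s).

(* For [a] in the tree, G_a^- = G_a^+ is the group denoted G_a. *)
Definition minimal : Prop :=
  forall a, a \in T -> a \in orient D ->
    Gminus a `<` Gv (origin a) /\ Gminus a `<` Gv (terminus a).

Definition single_loop (s : vertex D) (a : edge D) : Prop :=
  [/\ a \in orient D, forall s', s' = s & forall b, b = a \/ b = eopp a].

(* The isomorphism with the HNN extension is the natural one: it extends the
   map from G_s and sends the stable letter to t_a. *)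
Definition pi1_is_HNN (s : vertex D) (a : edge D) : Prop :=
  exists theta : {multiplicative
      HNN (fun g g' : vgroup s => phi a (in_v g) (in_v g')) -> pi1},
    [/\ bijective theta,
        forall g, theta (HNN_base _ g) = vgroup_pi1 g &
        theta (HNN_stable _) = stable a].

End FundamentalGroup.

Arguments Gv {D} s.
Arguments Zv {D} s.
Arguments phi_map {D} s a g.

(* Main.v *)
Require Import Defs.
From HB Require Import structures.
From mathcomp Require Import all_boot all_algebra.
From mathcomp Require Import boolp classical_sets.
From mathcomp Require Import zify.

Set Implicit Arguments.
Unset Strict Implicit.
Unset Printing Implicit Defensive.

Local Open Scope group_scope.
Local Open Scope classical_set_scope.

(** The proof rests on the normal form theorem for the fundamental group of a
    graph of groups, in the form of [reduced_unique]: two reduced path words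
    g t_(e_1) u_1 .. t_(e_n) u_n and g' t_(e'_1) u'_1 .. t_(e'_m) u'_m between
    the same vertices and with the same value have the same sequence of edges,
    and if n > 0 their leading coefficients lie in the same coset of the
    subgroup of e_1; if n = 0 they are equal.  In particular vertex groups embed.
    To prove it, all vertex groups are put inside their product K.
    A path word then becomes a word over K with one stable letter per edge, which
    acts on the right on the set of normal forms ([sstep], [srun_unique]).  The
    stable letters of the maximal tree have to act trivially; this is achieved by
    transporting normal forms along the tree to the vertex where a generator
    lives ([pi1_act]), which does not depend on the path because closed paths in
    a tree act trivially ([forest_closed_steps], [tpath_step]).

    Let z be central.  The theorem is now a matter of comparing two expressions
    for z x = x z for well chosen x.

    If z lies in some vertex group, the elements x = t_f k t_f^-1 with f in the tree
    and k outside the edge group show that z lies in the edge groups of the tree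
    around it, hence in all vertex groups; then x = t_e for the other edges gives z
    in Fix e ([elliptic_central]).  Conversely such elements commute with all
    generators ([kernel_central]).

    If z lies in no vertex group, take a shortest closed path word for z over all
    base vertices.  It is reduced, even cyclically.  Taking x in the vertex group
    shows that the group of its first edge is the whole vertex group, and x running
    over elements built on another edge leads to a contradiction.  Hence the graph
    is a single loop and both edge subgroups are the whole vertex group
    ([hyperbolic_central]).  In that case the group is the semidirect product of the
    vertex group by the infinite cyclic group generated by t, every element is
    t^m g, and t^m g is central exactly when g is fixed by phi and phi^m is
    conjugation by g; [loop_infinite_center] and [loop_finite_center] read off the
    centre from this description. *)


(** * Groups given by generators and relations *)

Section PresentedTheory.
Variables (X : choiceType) (R : word X -> word X -> Prop).

Lemma wclass_cat (u v : word X) :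
  wclass R (u ++ v) = wclass R u * wclass R v.
Proof.
apply/wclassP; apply: pres_cat; apply: pres_sym; exact: repr_wclass.
Qed.

Lemma wclass_inv x : wclass R [:: (x, false)] = (gen R x)^-1.
Proof.
have h : wclass R [:: (x, false)] * gen R x = 1.
  by rewrite /gen -wclass_cat; apply/wclassP; apply: (pres_cancel R x false).
by rewrite -[LHS](mulgK (gen R x)) h mul1g.
Qed.

Lemma presented_ind (P : presented R -> Prop) :
  P 1 -> (forall y x, P y -> P (y * gen R x)) ->
  (forall y x, P y -> P (y * (gen R x)^-1)) -> forall y, P y.
Proof.
move=> P1 Pgen PgenV y; rewrite -(wclassK y).
elim/last_ind: (repr y) => [|u [x b] ih]; first exact: P1.
rewrite -cats1 wclass_cat; case: b; first exact: Pgen.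
by rewrite wclass_inv; exact: PgenV.
Qed.

Section Action.
(* The letters need not act by bijections of the whole of [W]: everything is
   only required on the invariant part [ok].  This allows [W] to be a type of
   raw normal forms and [ok] to be the property of being reduced. *)
Variables (W : Type) (ok : W -> Prop) (act : W -> X * bool -> W).
Hypothesis act_ok : forall w l, ok w -> ok (act w l).
Hypothesis act_inv : forall w x b, ok w -> act (act w (x, b)) (x, ~~ b) = w.
Hypothesis act_rel : forall u v, R u v ->
  forall w, ok w -> foldl act w u = foldl act w v.

Lemma foldl_act_ok u w : ok w -> ok (foldl act w u).
Proof. by elim: u w => //= l u ih w /(act_ok l) /ih. Qed.

Lemma pres_eq_act u v : pres_eq R u v ->
  forall w, ok w -> foldl act w u = foldl act w v.
Proof.
elim=> {u v} //.
- by move=> u v _ ih w okw; rewrite ih.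
- by move=> u v w _ ih _ ih' z okz; rewrite ih // ih'.
- move=> u u' v v' _ ih _ ih' w okw.
  by rewrite !foldl_cat ih // ih' //; exact: foldl_act_ok.
- by move=> x b w okw /=; rewrite act_inv.
Qed.

Definition pact (w : W) (y : presented R) : W := foldl act w (repr y).

Lemma pact_wclass u w : ok w -> pact w (wclass R u) = foldl act w u.
Proof. by move=> okw; apply: pres_eq_act => //; exact: repr_wclass. Qed.

Lemma pactM x y w : ok w -> pact w (x * y) = pact (pact w x) y.
Proof.
by move=> okw; rewrite [LHS]pact_wclass // foldl_cat.
Qed.

Lemma pact1 w : ok w -> pact w 1 = w.
Proof. by move=> okw; rewrite [LHS]pact_wclass. Qed.

Lemma pact_ok x w : ok w -> ok (pact w x).
Proof. exact: foldl_act_ok. Qed.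

End Action.

(* The universal property of a presentation, obtained from the right
   action of the generators on [H] by multiplication by their images. *)
Section Lift.
Variables (H : groupType) (f : X -> H).

Definition letter_val (w : H) (l : X * bool) : H :=
  if l.2 then w * f l.1 else w * (f l.1)^-1.

Hypothesis f_rel : forall u v, R u v ->
  foldl letter_val 1 u = foldl letter_val 1 v.

Definition pres_lift (y : presented R) : H := pact letter_val 1 y.

Lemma foldl_letter_val w u : foldl letter_val w u = w * foldl letter_val 1 u.
Proof.
elim/last_ind: u w => [|u [x b] ih] w; first by rewrite /= mulg1.
by rewrite -cats1 !foldl_cat /= (ih w) /letter_val; case: b; rewrite /= mulgA.
Qed.

Lemma letter_val_inv w x b : True ->
  letter_val (letter_val w (x, b)) (x, ~~ b) = w.
Proof. by case: b => _; rewrite /letter_val /= ?mulgK ?mulgVK. Qed.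

Lemma letter_val_rel u v : R u v ->
  forall w, True -> foldl letter_val w u = foldl letter_val w v.
Proof.
by move=> uv w _; rewrite foldl_letter_val (f_rel uv) -foldl_letter_val.
Qed.

Lemma pres_liftM : {morph pres_lift : x y / x * y}.
Proof.
move=> x y; rewrite /pres_lift.
rewrite (@pactM H (fun=> True)) //; last exact: letter_val_rel.
  exact: foldl_letter_val.
exact: letter_val_inv.
Qed.

Lemma pres_lift_gen x : pres_lift (gen R x) = f x.
Proof.
rewrite /pres_lift (@pact_wclass H (fun=> True)) //=; last exact: letter_val_rel.
  by rewrite /letter_val /= mul1g.
exact: letter_val_inv.
Qed.

End Lift.

End PresentedTheory.

Lemma morph1 (G H : groupType) (f : G -> H) :
  {morph f : x y / x * y} -> f 1 = 1.
Proof. by move=> fM; apply: (@mulgI _ (f 1)); rewrite -fM !mulg1. Qed.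

Lemma morphV (G H : groupType) (f : G -> H) :
  {morph f : x y / x * y} -> {morph f : x / x^-1}.
Proof.
by move=> fM x; apply: (@mulgI _ (f x)); rewrite -fM !mulgV (morph1 fM).
Qed.

Lemma presented_morph_ext (X : choiceType) (R : word X -> word X -> Prop)
    (H : groupType) (f g : presented R -> H) :
  {morph f : x y / x * y} -> {morph g : x y / x * y} ->
  (forall x, f (gen R x) = g (gen R x)) -> f =1 g.
Proof.
move=> fM gM fg; apply: presented_ind; first by rewrite !morph1.
  by move=> y x ih; rewrite fM gM ih fg.
by move=> y x ih; rewrite fM gM ih (morphV fM) (morphV gM) fg.
Qed.

(** * Normal forms for several stable letters over one group *)

(** Stable letters t_e over [K], where t_(sopp e) is the inverse of t_e and
    x t_e = t_e y for [sphi e x y].  The relation [sphi e] is the graph of an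
    isomorphism between two subgroups of [K]; injectivity follows from
    [sphi_inj] for the opposite edge. *)
Record stableSystem (K : groupType) (E : eqType) := StableSystem {
  sopp : E -> E;
  sphi : E -> K -> K -> Prop;
  soppK : involutive sopp;
  sopp_neq : forall e, sopp e != e;
  sphi1 : forall e, sphi e 1 1;
  sphi_inj : forall e y, sphi e 1 y -> y = 1;
  sphi_div : forall e x y x' y', sphi e x y -> sphi e x' y' ->
    sphi e (x^-1 * x') (y^-1 * y');
  sphi_opp : forall e x y, sphi e x y -> sphi (sopp e) y x
}.

Section NormalForms.
Variables (K : groupType) (E : eqType) (S : stableSystem K E).

Definition sdom (e : E) (x : K) : Prop := exists y, sphi S e x y.

Lemma sdom_div e x y : sdom e x -> sdom e y -> sdom e (x^-1 * y).
Proof. by case=> x' hx [y' hy]; exists (x'^-1 * y'); exact: sphi_div. Qed.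

Lemma sdom1 e : sdom e 1.
Proof. by exists 1; exact: sphi1. Qed.

Lemma sdomV e x : sdom e x -> sdom e x^-1.
Proof. by move=> h; rewrite -[x^-1]mulg1; exact: sdom_div (sdom1 e). Qed.

Lemma sdomM e x y : sdom e x -> sdom e y -> sdom e (x * y).
Proof. by move=> /sdomV hx hy; rewrite -[x]invgK; exact: sdom_div. Qed.

Lemma sdomMl e x y : sdom e x -> sdom e (x * y) -> sdom e y.
Proof. by move=> hx hxy; rewrite -(mulKg x y); exact: sdom_div. Qed.

Lemma sphiV e x y : sphi S e x y -> sphi S e x^-1 y^-1.
Proof. by move=> h; have := sphi_div h (sphi1 S e); rewrite !mulg1. Qed.

Lemma sphiM e x y x' y' :
  sphi S e x y -> sphi S e x' y' -> sphi S e (x * x') (y * y').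
Proof. by move=> /sphiV h h'; have := sphi_div h h'; rewrite !invgK. Qed.

Lemma sphi_fun e x y y' : sphi S e x y -> sphi S e x y' -> y = y'.
Proof.
move=> h h'; have := sphi_div h h'; rewrite mulVg => /sphi_inj hy.
by rewrite -[y]mulg1 -hy mulVKg.
Qed.

Definition simg (e : E) (x : K) : K := xget 1 [set y | sphi S e x y].

Lemma simgP e x y : sphi S e x y -> simg e x = y.
Proof.
move=> h; rewrite /simg; case: xgetP => [z _ /= hz|/(_ y)] //.
exact: sphi_fun hz h.
Qed.

Lemma simg_dom e x : sdom e x -> sphi S e x (simg e x).
Proof. by case=> y h; rewrite (simgP h). Qed.

(** The subgroup itself must be represented by 1: a letter t_e then cancels
    with a preceding inverse letter exactly when the representative is 1. *)
Definition srep (e : E) (g : K) : K :=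
  if `[< sdom e g >] then 1 else xget 1 [set x | sdom e (x^-1 * g)].

Lemma srep_dom e g : sdom e ((srep e g)^-1 * g).
Proof.
rewrite /srep; case: asboolP => [h|_]; first by rewrite invg1 mul1g.
by case: xgetP => [x _ //|/(_ g) /=]; rewrite mulVg => /(_ (sdom1 e)).
Qed.

Lemma srep_coset e g g' : sdom e (g^-1 * g') -> srep e g = srep e g'.
Proof.
move=> h.
have eqd : sdom e g <-> sdom e g'.
  split=> h'; first by rewrite -(mulVKg g g'); exact: sdomM.
  have := sdomM h' (sdomV h); rewrite invgM invgK mulgA mulgV mul1g.
  by [].
rewrite /srep (asbool_equiv_eq eqd); case: ifP => // _; congr (xget _ _).
apply/funext => x /=; apply/propext; split=> hx.
  by have := sdomM hx h; rewrite -mulgA mulVKg.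
by have := sdomM hx (sdomV h); rewrite invgM invgK -mulgA mulVKg.
Qed.

Lemma srepK e g : srep e (srep e g) = srep e g.
Proof. by apply: srep_coset; exact: srep_dom. Qed.

Lemma srep1 e g : sdom e g -> srep e g = 1.
Proof. by move=> h; rewrite /srep; case: asboolP. Qed.

Lemma srep_eq e g g' : srep e g = srep e g' -> sdom e (g^-1 * g').
Proof.
move=> h; have h1 := sdomV (srep_dom e g); have := srep_dom e g'.
by rewrite -h => h2; have := sdomM h1 h2; rewrite invgM invgK -mulgA mulVKg.
Qed.

(** A state [([:: (r_n, e_n); ..; (r_1, e_1)], g)] stands for the normal form
    r_1 t_(e_1) .. r_n t_(e_n) g. *)
Definition state := (seq (K * E) * K)%type.

Definition smul (w : state) (x : K) : state := (w.1, w.2 * x).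

(** Multiplication of a normal form by t_e: write g = r x with r the
    representative and replace x t_e by t_e y; the letter t_e cancels if the last
    letter is its inverse and r = 1. *)
Definition sstep (e : E) (w : state) : state :=
  let r := srep e w.2 in
  let y := simg e (r^-1 * w.2) in
  if w.1 is (r', e') :: s' then
    if (e' == sopp S e) && `[< sdom e w.2 >] then (s', r' * y)
    else ((r, e) :: w.1, y)
  else ([:: (r, e)], y).

Fixpoint reduced_stack (s : seq (K * E)) : Prop :=
  if s is (r, e) :: s' then
    [/\ srep e r = r, reduced_stack s' &
        if s' is (r', e') :: _ then ~ (e' = sopp S e /\ sdom e r) else True]
  else True.

Definition sok (w : state) : Prop := reduced_stack w.1.

Definition head_cancels (e : E) (s : seq (K * E)) (g : K) : Prop :=
  if s is (_, e') :: _ then e' = sopp S e /\ sdom e g else False.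

Lemma sstep_push e s g : ~ head_cancels e s g ->
  sstep e (s, g) = ((srep e g, e) :: s, simg e ((srep e g)^-1 * g)).
Proof.
case: s => [|[r' e'] s] //= h; rewrite /sstep /=.
case: eqP => //= he; case: asboolP => //= hg.
by case: h.
Qed.

Lemma sstep_pop e r s g : sdom e g ->
  sstep e ((r, sopp S e) :: s, g) = (s, r * simg e g).
Proof.
move=> h; rewrite /sstep /= eqxx /=; case: asboolP => //= _.
by rewrite srep1 // invg1 mul1g.
Qed.

Lemma head_cancels_cases e s g : head_cancels e s g ->
  exists r s', s = (r, sopp S e) :: s' /\ sdom e g.
Proof. by case: s => [|[r e'] s] //= [-> h]; exists r, s. Qed.

Lemma sstep_ok e w : sok w -> sok (sstep e w).
Proof.
case: w => s g; rewrite /sok /= => oks.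
have [/head_cancels_cases[r [s' [es hg]]]|hc] := EM (head_cancels e s g).
  by rewrite es sstep_pop //=; move: oks; rewrite es => -[].
rewrite sstep_push //=; split=> //; first exact: srepK.
case: s hc {oks} => [|[r e'] s] //= hc [he hr]; apply: hc; split=> //.
rewrite -[g](mulVKg (srep e g)); apply: sdomM (srep_dom _ _) => //.
Qed.

Lemma smul_ok x w : sok w -> sok (smul w x).
Proof. by []. Qed.

(** Multiplying by t_e and then by its inverse creates and removes the same
    entry of the stack; if the first step cancels an entry, reducedness of the
    stack ensures that the second one puts it back. *)
Lemma sstepK e w : sok w -> sstep (sopp S e) (sstep e w) = w.
Proof.
case: w => s g; rewrite /sok /= => oks.
have [/head_cancels_cases[r [s' [es hg]]]|hc] := EM (head_cancels e s g).
  move: oks; rewrite es => -[rr oks hr]; rewrite sstep_pop //.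
  have hp := simg_dom hg; have hd : sdom (sopp S e) (simg e g).
    by exists g; exact: sphi_opp.
  have er : srep (sopp S e) (r * simg e g) = r.
    by rewrite -[RHS]rr; apply: srep_coset; rewrite invgM -mulgA mulVg mulg1;
       exact: sdomV.
  rewrite sstep_push; first by rewrite er mulKg (simgP (sphi_opp hp)).
  case: s' hr {oks es} => [|[r' e'] s'] /= hr; first by case.
  case=> he hd'; apply: hr; split=> //.
  by have := sdomM hd' (sdomV hd); rewrite mulgK.
rewrite sstep_push //; have hp := simg_dom (srep_dom e g).
have hd : sdom (sopp S e) (simg e ((srep e g)^-1 * g)).
  by exists ((srep e g)^-1 * g); exact: sphi_opp.
have := sstep_pop (srep e g) s hd; rewrite soppK => ->.
by rewrite (simgP (sphi_opp hp)) mulVKg.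
Qed.

(** The defining relation x t_e = t_e phi_e(x). *)
Lemma sstep_smul e w x y : sphi S e x y ->
  sstep e (smul w x) = smul (sstep e w) y.
Proof.
move=> hxy; have hx : sdom e x by exists y.
case: w => s g; rewrite /smul /=.
have er : srep e (g * x) = srep e g.
  by apply/esym/srep_coset; rewrite mulKg.
have eqd : sdom e (g * x) <-> sdom e g.
  split=> [h|h]; last exact: sdomM.
  by have := sdomM h (sdomV hx); rewrite mulgK.
have ey z : sdom e (z^-1 * g) -> simg e (z^-1 * (g * x)) = simg e (z^-1 * g) * y.
  by move=> hz; apply: simgP; rewrite mulgA; apply: sphiM => //; exact: simg_dom.
have [/head_cancels_cases[r [s' [-> hg]]]|hc] := EM (head_cancels e s g).
  have hgx : sdom e (g * x) by exact/eqd.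
  rewrite !sstep_pop //.
  have := ey 1; rewrite invg1 !mul1g => -> //.
  by rewrite /= mulgA.
have hc' : ~ head_cancels e s (g * x).
  by case: s hc => [|[r e'] s] //= hc [he /eqd hg]; apply: hc.
by rewrite !sstep_push // er ey //; exact: srep_dom.
Qed.

Definition srun (w : state) (l : seq (E * K)) : state :=
  foldl (fun w p => smul (sstep p.1 w) p.2) w l.

Definition snonback (p q : E * K) : Prop := ~ (q.1 = sopp S p.1 /\ sdom q.1 p.2).

Fixpoint sreduced (l : seq (E * K)) : Prop :=
  if l is p :: l' then
    (if l' is q :: _ then snonback p q else True) /\ sreduced l'
  else True.

(** No cancellation ever happens along a reduced word.  After the letter t_e the
    coefficient lies in the subgroup attached to the inverse of e, so that
    cancellation with the next letter only depends on the next coefficient. *)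
Lemma srun_reduced l s g : sreduced l ->
  (if l is p :: _ then ~ head_cancels p.1 s g else True) ->
  exists s' g', [/\ srun (s, g) l = (s' ++ s, g'),
    unzip2 s' = rev (unzip1 l) &
    if l is p :: _ then exists s'', s' = rcons s'' (srep p.1 g, p.1) else True].
Proof.
elim: l s g => [|[e k] l ih] s g /=; first by exists [::], g.
move=> [hnb hred] hc; rewrite sstep_push //.
set y := simg _ _; have hy : sdom (sopp S e) y.
  by exists ((srep e g)^-1 * g); apply: sphi_opp; apply: simg_dom; exact: srep_dom.
have [|s' [g' [-> es' hs']]] := ih ((srep e g, e) :: s) (y * k) hred.
  case: l hnb hred {ih} => [|[e' k'] l] //= hnb _ [he hd]; apply: hnb.
  have he' : e' = sopp S e by rewrite he soppK.
  by split=> //=; rewrite he' in hd *; exact: sdomMl hy hd.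
exists (rcons s' (srep e g, e)), g'; split.
- by rewrite cat_rcons.
- by rewrite /unzip2 map_rcons -/(unzip2 s') es' rev_cons.
- by exists s'.
Qed.

(** The bottom of the stack records the coset of the leading coefficient, hence
    the second assertion.  For [l' = [::]] this is Britton's lemma. *)
Lemma srun_unique g g' l l' : sreduced l -> sreduced l' ->
  srun ([::], g) l = srun ([::], g') l' ->
  unzip1 l = unzip1 l' /\
  if l is p :: _ then sdom p.1 (g^-1 * g') else g = g'.
Proof.
move=> hl hl' eqr.
have [|s [h [er es hs]]] := srun_reduced (s := [::]) (g := g) hl.
  by case: l {hl eqr} => [|p l]; last case.
have [|s' [h' [er' es' hs']]] := srun_reduced (s := [::]) (g := g') hl'.
  by case: l' {hl' eqr} => [|p l']; last case.
have ess : s = s' by move: eqr; rewrite er er' !cats0 => -[].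
have el : unzip1 l = unzip1 l' by apply: (can_inj revK); rewrite -es -es' ess.
split=> //; move: el hs hs' eqr {er er' es es' hl hl'}.
case: l l' => [|[e k] l] [|[f k'] l'] //=; first by move=> _ _ _ [].
move=> [-> _] [s1 e1] [s1' e1'] _; apply: srep_eq.
by move: ess; rewrite e1 e1' => /rcons_inj[_ ->].
Qed.

End NormalForms.

(** * Paths in trees *)

Lemma not_sorted_split (A : Type) (r : rel A) (p : seq A) : ~~ sorted r p ->
  exists p1 a b p2, p = p1 ++ a :: b :: p2 /\ ~~ r a b.
Proof.
elim: p => [|a [|b p] ih] //=; rewrite negb_and.
case hr: (r a b) => /= h; last by exists [::], a, b, p; rewrite hr.
by have [p1 [c [d [p2 [-> hcd]]]]] := ih h; exists (a :: p1), c, d, p2.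
Qed.

Lemma not_uniq_split (A : Type) (B : eqType) (f : A -> B) (p : seq A) :
  ~~ uniq (map f p) ->
  exists p1 a p2 b p3, p = p1 ++ a :: p2 ++ b :: p3 /\ f a = f b.
Proof.
elim: p => [|a p ih] //=; rewrite negb_and negbK => /orP[|/ih]; last first.
  by move=> [p1 [c [p2 [d [p3 [-> h]]]]]]; exists (a :: p1), c, p2, d, p3.
move=> h; suff [p2 [b [p3 [-> e]]]] : exists p2 b p3, p = p2 ++ b :: p3 /\ f a = f b.
  by exists [::], a, p2, b, p3.
elim: p h {ih} => [|b p ih] //=; rewrite inE => /orP[/eqP e|/ih].
  by exists [::], b, p.
by move=> [p2 [c [p3 [-> e]]]]; exists (b :: p2), c, p3.
Qed.

Section EdgePaths.
Variable X : finGraph.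
Implicit Types (s : vertex X) (p : seq (edge X)).

Fixpoint epath s p : bool :=
  if p is a :: p' then (origin a == s) && epath (terminus a) p' else true.

Definition eend s p := last s [seq terminus a | a <- p].

Lemma epath_cat s p q : epath s (p ++ q) = epath s p && epath (eend s p) q.
Proof. by elim: p s => //= a p ih s; rewrite ih andbA. Qed.

Lemma eend_cat s p q : eend s (p ++ q) = eend (eend s p) q.
Proof. by rewrite /eend map_cat last_cat. Qed.

Lemma terminus_opp (a : edge X) : terminus (eopp a) = origin a.
Proof. by rewrite terminusE eoppK. Qed.

Lemma connect_epath (E : {set edge X}) u v : connect (adjacent E) u v ->
  exists p, [/\ epath u p, eend u p = v & all (mem E) p].
Proof.
case/connectP=> p hp ->; elim: p u hp => [|w p ih] u /=.
  by exists [::].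
case/andP => /exists_inP[a aE /andP[/eqP <- /eqP <-]] /ih[q [hq eq aq]].
by exists (a :: q); rewrite /= eqxx hq aq aE.
Qed.

Definition erev p : seq (edge X) := rev [seq eopp a | a <- p].

Lemma epath_rev s p : epath s p ->
  epath (eend s p) (erev p) /\ eend (eend s p) (erev p) = s.
Proof.
elim: p s => [|a p ih] s //= /andP[/eqP <- /ih[h1 h2]].
rewrite /erev /= rev_cons -cats1 -/(erev p) epath_cat eend_cat /=.
rewrite /eend /= -/(eend _ _) -/(eend _ (erev p)) in h1 h2 *.
by rewrite h1 h2 /= -terminusE eqxx terminus_opp.
Qed.

Section PathAction.
Variables (W : Type) (ok : W -> Prop) (step : edge X -> W -> W).
Hypothesis step_ok : forall a w, ok w -> ok (step a w).
Hypothesis stepK : forall a w, ok w -> step (eopp a) (step a w) = w.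

Definition steps (w : W) p := foldl (fun w a => step a w) w p.

Lemma steps_ok p w : ok w -> ok (steps w p).
Proof. by elim: p w => //= a p ih w /(step_ok a) /ih. Qed.

Lemma steps_cat w p q : steps w (p ++ q) = steps (steps w p) q.
Proof. by rewrite /steps foldl_cat. Qed.

Lemma steps_rev p w : ok w -> steps (steps w p) (erev p) = w.
Proof.
elim: p w => //= a p ih w okw.
rewrite /erev /= rev_cons -cats1 -/(erev p) steps_cat ih /=; last exact: step_ok.
exact: stepK.
Qed.

(** A nonempty closed path which is not a circuit either backtracks, or visits a
    vertex twice, or starts and ends with opposite edges; in each case shorter closed paths can be used. *)
Lemma forest_closed_steps (E : {set edge X}) :
  (forall p, circuit p -> ~~ all (mem E) p) ->
  forall p s w, all (mem E) p -> epath s p -> eend s p = s -> ok w ->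
    steps w p = w.
Proof.
move=> acyclic p; have [n] := ubnP (size p).
elim: n p => // n ih [|a p] // hn s w pE hp ep okw.
have [hs|] := boolP (sorted [rel b c | c != eopp b] (a :: p)); last first.
  case/not_sorted_split=> p1 [b [c [p2 [e /negPn/eqP ec]]]].
  have okw1 : ok (steps w p1) by exact: steps_ok.
  rewrite e ec steps_cat /= stepK // -steps_cat; apply: (ih _ _ s) => //.
  - by move: hn; rewrite e !size_cat /= !addnS; lia.
  - by move: pE; rewrite e !all_cat /= => /and4P[-> _ _].
  - move: hp; rewrite e ec !epath_cat /= => /and4P[-> /eqP <- _].
    by rewrite terminus_opp.
  - move: hp ep; rewrite e ec epath_cat !eend_cat /= => /and4P[_ /eqP <- _ _].
    by rewrite /eend /= terminus_opp.
have [hu|] := boolP (uniq [seq origin b | b <- a :: p]); last first.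
  case/not_uniq_split=> p1 [b [p2 [c [p3 [e eo]]]]].
  move: hp pE ep hn; rewrite e.
  rewrite -cat_cons epath_cat all_cat eend_cat size_cat epath_cat all_cat.
  rewrite eend_cat size_cat (steps_cat w) (steps_cat (steps w p1)).
  case/andP=> hp1 /andP[hp2 hp3] /andP[pE1 /andP[pE2 pE3]] ep hn.
  have e1 : eend s p1 = origin b by move: hp2 => /= /andP[/eqP].
  have e2 : eend (eend s p1) (b :: p2) = eend s p1.
    have /= /andP[/eqP <- _] := hp3; by rewrite -eo e1.
  have okw1 : ok (steps w p1) by exact: steps_ok.
  rewrite (ih (b :: p2) _ (eend s p1)) //; last first.
    by move: hn => /=; lia.
  rewrite -steps_cat; apply: (ih _ _ s) => //.
  - by move: hn; rewrite size_cat /=; lia.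
  - by rewrite all_cat pE1 pE3.
  - by rewrite epath_cat hp1 -e2.
  - by rewrite eend_cat -[in LHS]e2.
have [ea|na] := eqVneq (last a p) (eopp a).
  case/lastP: p ea hn pE hp ep {hs hu} => [|p b] /=.
    by move=> /esym/eqP; rewrite (negbTE (eopp_neq a)).
  rewrite last_rcons => -> hn pE /andP[/eqP os hp] ep.
  have h1 : epath (terminus a) p.
    by move: hp; rewrite -cats1 epath_cat => /andP[].
  have h2 : eend (terminus a) p = terminus a.
    by move: hp; rewrite -cats1 epath_cat /= andbT terminusE => /andP[_ /eqP].
  have okw1 : ok (step a w) by exact: step_ok.
  rewrite -cats1 steps_cat (ih p _ (terminus a)) //= ?stepK //.
    by move: hn; rewrite size_rcons; lia.
  by move: pE; rewrite all_rcons => /and3P[].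
suff: circuit (a :: p) by move=> /acyclic; rewrite pE.
rewrite /circuit hu andbT /= rcons_path /=.
have -> : terminus (last a p) = origin a.
  by move: hp ep => /andP[/eqP -> _]; rewrite /eend /= last_map.
rewrite eqxx /=; apply/andP; split; last first.
  by apply/eqP => e; move/eqP: na; apply; rewrite [in RHS]e eoppK.
move: hp hs => /= /andP[_]; elim: p a {hn pE ep hu na ih} => //= b p ihp a.
by move=> /andP[/eqP e hp] /andP[hb hs]; rewrite e eqxx hb ihp.
Qed.

End PathAction.

(** A maximal tree of a connected graph contains every vertex: otherwise an edge
    leaving it could be added, and no circuit can run through the new vertex. *)
Lemma maximal_tree_spans (T : subgraph X) :
  connected_graph (X := X) [set: _]%SET [set: _]%SET -> maximal_tree T ->
  forall v, v \in sub_vertices T.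
Proof.
move=> [_ Xcon] [[[T0 Tcon] acyclic] maxT] v.
apply/negPn/negP => vT; have [u uT] := set0Pn _ T0.
have [a [aT aT']] : exists a : edge X,
    origin a \in sub_vertices T /\ terminus a \notin sub_vertices T.
  apply: contrapT => hno.
  have [p [hp ep _]] := connect_epath (Xcon u v (finset.in_setT _) (finset.in_setT _)).
  move: vT; rewrite -ep => /negP; apply.
  elim: p u uT hp {ep} => //= b p ih u uT /andP[/eqP eb /ih]; apply.
  by apply/negPn/negP => bT; apply: hno; exists b; rewrite eb.
have h1 b : b \in a |: (eopp a |: sub_edges T) ->
    eopp b \in a |: (eopp a |: sub_edges T).
  rewrite !inE => /or3P[/eqP->|/eqP->|/sub_edges_opp ->]; last by rewrite !orbT.
    by rewrite eqxx orbT.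
  by rewrite eoppK eqxx.
have h2 b : b \in a |: (eopp a |: sub_edges T) ->
    origin b \in terminus a |: sub_vertices T.
  rewrite !inE => /or3P[/eqP->|/eqP->|/sub_edges_origin ->].
  - by rewrite aT orbT.
  - by rewrite -terminusE eqxx.
  - by rewrite orbT.
have treeT' : tree (Subgraph h1 h2).
  have sub x y : connect (adjacent (sub_edges T)) x y ->
      connect (adjacent (a |: (eopp a |: sub_edges T))) x y.
    apply: connect_sub => {}x {}y /exists_inP[b bT hb]; apply: connect1.
    by apply/exists_inP; exists b => //; rewrite !inE bT !orbT.
  have hub x : x \in terminus a |: sub_vertices T ->
      connect (adjacent (a |: (eopp a |: sub_edges T))) x (origin a) /\
      connect (adjacent (a |: (eopp a |: sub_edges T))) (origin a) x.
    rewrite !inE => /orP[/eqP->|xT]; last by split; apply: sub; apply: Tcon.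
    split; apply: connect1; apply/exists_inP.
      by exists (eopp a); rewrite ?inE ?eqxx ?orbT // -terminusE terminus_opp !eqxx.
    by exists a; rewrite ?inE ?eqxx.
  split=> [|p hp]; first split=> /=.
  - by apply/set0Pn; exists (origin a); rewrite !inE aT orbT.
  - move=> x y /hub[hx _] /hub[_ hy]; exact: connect_trans hx hy.
  apply/negP => /allP pT'; have cp : cycle [rel a b | (terminus a == origin b)
    && (b != eopp a)] p by case/and3P: hp.
  have [ap|nap] := boolP (a \in p).
    have bT : next p a \in a |: (eopp a |: sub_edges T).
      by apply: pT'; rewrite mem_next.
    have /andP[/eqP ob nb] := next_cycle cp ap.
    move: bT; rewrite !inE (negbTE nb) /= => /orP[/eqP e|/sub_edges_origin].
      by move: aT'; rewrite ob e aT.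
    by rewrite -ob (negbTE aT').
  have [ap|nap'] := boolP (eopp a \in p).
    have bT : prev p (eopp a) \in a |: (eopp a |: sub_edges T).
      by apply: pT'; rewrite mem_prev.
    have /andP[/eqP ob nb] := prev_cycle cp ap; rewrite -terminusE in ob.
    move: bT; rewrite !inE => /or3P[/eqP e|/eqP e|/sub_edges_opp/sub_edges_origin].
    - by move: nb; rewrite e eqxx.
    - by move: aT'; rewrite -ob e terminus_opp aT.
    - by rewrite -terminusE ob (negbTE aT').
  have := acyclic p hp; rewrite -has_predC => /hasP[b bp /=].
  have := pT' b bp; rewrite !inE => /or3P[/eqP e|/eqP e|-> //].
    by rewrite -e bp in nap.
  by rewrite -e bp in nap'.
have [e _] := maxT _ treeT' (finset.subsetUr _ _)
  (fintype.subset_trans (finset.subsetUr _ _) (finset.subsetUr _ _)).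
by move: aT'; rewrite -e /= !inE eqxx.
Qed.

End EdgePaths.

(** * The action of the fundamental group on normal forms *)

(* The product of all vertex groups is a single group containing each of them,
   so that words whose coefficients lie in different vertex groups can be
   treated as words over one group. *)
Section ProductGroup.
Variables (I : eqType) (G : I -> groupType).

Definition prodg : Type := forall i, G i.
HB.instance Definition _ := gen_eqMixin prodg.
HB.instance Definition _ := gen_choiceMixin prodg.

Definition prodg_mul (x y : prodg) : prodg := fun i => x i * y i.
Definition prodg_one : prodg := fun i => 1.
Definition prodg_inv (x : prodg) : prodg := fun i => (x i)^-1.

Lemma prodg_mulA : associative prodg_mul.
Proof. by move=> x y z; apply: functional_extensionality_dep => i; apply: mulgA. Qed.
Lemma prodg_mul1g : left_id prodg_one prodg_mul.
Proof. by move=> x; apply: functional_extensionality_dep => i; apply: mul1g. Qed.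
Lemma prodg_mulg1 : right_id prodg_one prodg_mul.
Proof. by move=> x; apply: functional_extensionality_dep => i; apply: mulg1. Qed.
Lemma prodg_mulVg : left_inverse prodg_one prodg_inv prodg_mul.
Proof. by move=> x; apply: functional_extensionality_dep => i; apply: mulVg. Qed.
Lemma prodg_mulgV : right_inverse prodg_one prodg_inv prodg_mul.
Proof. by move=> x; apply: functional_extensionality_dep => i; apply: mulgV. Qed.

HB.instance Definition _ := isGroup.Build prodg
  prodg_mulA prodg_mul1g prodg_mulg1 prodg_mulVg prodg_mulgV.

Definition prodg_in (i : I) (g : G i) : prodg := dfwith prodg_one g.

Lemma prodg_inM i : {morph @prodg_in i : x y / x * y}.
Proof.
move=> x y; apply: functional_extensionality_dep => j.
rewrite /prodg_in -[RHS]/(dfwith prodg_one x j * dfwith prodg_one y j).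
have [e|ne] := eqVneq i j; last by rewrite !dfwith_out // mulg1.
by case: j / e; rewrite !dfwith_in.
Qed.

Lemma prodg_in_inj i : injective (@prodg_in i).
Proof.
by move=> x y /(congr1 (fun f : prodg => f i)); rewrite /prodg_in !dfwith_in.
Qed.

End ProductGroup.

Lemma mult1 (G H : groupType) (f : {multiplicative G -> H}) : f 1 = 1.
Proof. exact: (morph1 (@gmulfM _ _ f)). Qed.

Lemma multV (G H : groupType) (f : {multiplicative G -> H}) :
  {morph f : x / x^-1}.
Proof. exact: (morphV (@gmulfM _ _ f)). Qed.

Section GraphOfGroups.
Variable D : decomposedGraphOfGroups.
Notation T := (sub_edges (dgg_tree D)).
Implicit Types (u v : velt D) (a e f : edge D) (s : vertex D).

(** The product in the common vertex group; it is only meaningful when [u] and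
    [v] have the same tag. *)
Definition vmul u v : velt D := in_v (tagged u * tagged_as u v).
Definition vinv u : velt D := in_v (tagged u)^-1.
Definition vone s : velt D := in_v (1 : vgroup s).

Lemma tag_vinv u : tag (vinv u) = tag u. Proof. by []. Qed.

Lemma vmul_in s (g h : vgroup s) : vmul (in_v g) (in_v h) = in_v (g * h).
Proof. by rewrite /vmul tagged_asE. Qed.

Lemma in_v_inj s : injective (@in_v D s).
Proof. exact: eq_from_Tagged. Qed.

Lemma in_v_tag u s : tag u = s -> exists g : vgroup s, u = in_v g.
Proof. by case: u => t g /= <-; exists g. Qed.

(** ** Values of vertex elements in the fundamental group *)

Lemma velt_pi1M u v : tag u = tag v ->
  velt_pi1 (vmul u v) = velt_pi1 u * velt_pi1 v.
Proof.
move=> /esym /in_v_tag; case: u => s g [h ->] /=.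
rewrite -/(in_v g) vmul_in; apply: (etrans _ (wclass_cat _ _ _)).
by apply/wclassP; apply: pres_rel; exact: pi1_rel_mul.
Qed.

Lemma vgroup_pi1M s : {morph @vgroup_pi1 D s : x y / x * y}.
Proof. by move=> x y; rewrite -velt_pi1M // vmul_in. Qed.

Lemma vgroup_pi1_1 s : vgroup_pi1 (1 : vgroup s) = 1.
Proof. exact: (morph1 (@vgroup_pi1M s)). Qed.

Lemma velt_pi1_1 s : velt_pi1 (vone s) = 1.
Proof. exact: vgroup_pi1_1. Qed.

Lemma velt_pi1V u : velt_pi1 (vinv u) = (velt_pi1 u)^-1.
Proof. by case: u => s g; exact: (morphV (@vgroup_pi1M s)). Qed.

Lemma stable_tree a : a \in T -> stable a = 1.
Proof. by move=> aT; apply/wclassP; apply: pres_rel; exact: pi1_rel_tree. Qed.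

Lemma stable_opp a : stable (eopp a) = (stable a)^-1.
Proof.
rewrite /stable -wclass_inv; apply/wclassP; apply: pres_rel.
exact: pi1_rel_opp.
Qed.

Lemma pi1_ind (P : pi1 D -> Prop) : P 1 ->
  (forall x u, P x -> P (x * velt_pi1 u)) ->
  (forall x a, P x -> P (x * stable a)) -> forall x, P x.
Proof.
move=> P1 Pu Pa; apply: presented_ind => // x [u|a] Px.
- exact: Pu.
- exact: Pa.
- by have := Pu _ (vinv u) Px; rewrite velt_pi1V.
- by have := Pa _ (eopp a) Px; rewrite stable_opp.
Qed.

Lemma pi1_center x : (forall u, commute x (velt_pi1 u)) ->
  (forall a, commute x (stable a)) -> center (pi1 D) x.
Proof.
move=> hu ha; apply: pi1_ind; first exact: commute1.
  by move=> y u hy; apply: commuteM.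
by move=> y a hy; apply: commuteM.
Qed.

(** ** Edge isomorphisms *)

Definition vdom e u : Prop := exists v, phi e u v.

(** An edge is positive or the opposite of a positive edge, but not both, so
    that [phi e] comes from a single constructor. *)
Lemma phi_shape e :
  (exists (a : {a | a \in orient D}), e = val a /\ forall u v, phi e u v <->
     exists h, u = in_v (mono_o a h) /\ v = in_v (mono_e a h)) \/
  (exists (a : {a | a \in orient D}), e = eopp (val a) /\
   forall u v, phi e u v <->
     exists h, u = in_v (mono_e a h) /\ v = in_v (mono_o a h)).
Proof.
have nor (a b : {a | a \in orient D}) : val a <> eopp (val b).
  move=> h; have := orientP (val b).
  by rewrite (valP b) -h (valP a).
have [ho|hno] := boolP (e \in orient D).
  have [a ea] : exists a : {a | a \in orient D}, e = val a by exists (Sub e ho).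
  left; exists a; split=> // u v; split; last first.
    by move=> [h [-> ->]]; rewrite ea; exact: phi_pos.
  move=> p; have {p} : exists2 e', e' = val a & phi e' u v by exists e.
  case=> e' ee p; case: e' u v / p ee => b h; last by move/esym/nor.
  by move/val_inj <-; exists h.
have [a ea] : exists a : {a | a \in orient D}, e = eopp (val a).
  have ho : eopp e \in orient D by have := orientP e; rewrite (negbTE hno).
  by exists (Sub (eopp e) ho); rewrite /= eoppK.
right; exists a; split=> // u v; split; last first.
  by move=> [h [-> ->]]; rewrite ea; exact: phi_neg.
move=> p; have {p} : exists2 e', e' = eopp (val a) & phi e' u v by exists e.
case=> e' ee p; case: e' u v / p ee => b h; first by move/nor.
by move/(inv_inj (@eoppK D))/val_inj <-; exists h.
Qed.

Lemma phi_tag e u v : phi e u v -> tag u = origin e /\ tag v = terminus e.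
Proof.
case=> a h /=; first by [].
by rewrite -terminusE terminus_opp.
Qed.

Lemma phi_opp e u v : phi e u v -> phi (eopp e) v u.
Proof.
case=> a h; first exact: phi_neg.
by rewrite eoppK; exact: phi_pos.
Qed.

Lemma phiM e u v u' v' : phi e u v -> phi e u' v' ->
  phi e (vmul u u') (vmul v v').
Proof.
case: (phi_shape e) => -[a [_ h]] /h[x [-> ->]] /h[y [-> ->]];
  by apply/h; exists (x * y); rewrite !vmul_in !gmulfM.
Qed.

Lemma phiV e u v : phi e u v -> phi e (vinv u) (vinv v).
Proof.
case: (phi_shape e) => -[a [_ h]] /h[x [-> ->]];
  apply/h; exists x^-1; rewrite /vinv /=.
  by rewrite !multV.
by rewrite !multV.
Qed.

Lemma phi_vone e : phi e (vone (origin e)) (vone (terminus e)).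
Proof.
case: (phi_shape e) => -[a [-> h]]; apply/h; exists 1;
  rewrite !mult1 //.
by rewrite /vone terminus_opp -terminusE.
Qed.

Lemma phi_inj e u v v' : phi e u v -> phi e u v' -> v = v'.
Proof.
case: (phi_shape e) => -[a [_ h]] /h[x [-> ->]] /h[y [e1 ->]];
  move/in_v_inj: e1.
  by move=> /(@mono_o_inj D) ->.
by move=> /(@mono_e_inj D) ->.
Qed.

Lemma phi_stable e u v : phi e u v ->
  velt_pi1 u = stable e * velt_pi1 v * (stable e)^-1.
Proof.
have pos (a : {a | a \in orient D}) h : velt_pi1 (in_v (mono_o a h)) =
    stable (val a) * velt_pi1 (in_v (mono_e a h)) * (stable (val a))^-1.
  rewrite /stable -wclass_inv.
  set x := stable (val a); set y := velt_pi1 (in_v (mono_e a h)).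
  have -> : gen (@pi1_rel D) (inr (val a)) * y * wclass (@pi1_rel D)
      [:: (inr (val a), false)] =
    wclass (@pi1_rel D)
      [:: tletter (val a); vletter (mono_e a h); tletterV (val a)].
    by rewrite -[RHS]/(wclass _ ([:: _] ++ [:: _] ++ [:: _])) !wclass_cat mulgA.
  by apply/wclassP; apply: pres_rel; exact: pi1_rel_edge.
case=> a h; first exact: pos.
by rewrite pos stable_opp invgK !mulgA mulVg mul1g mulgVK.
Qed.

Lemma vdomV e u : vdom e u -> vdom e (vinv u).
Proof. by move=> [u' hu]; exists (vinv u'); exact: phiV. Qed.

(** ** The system of stable letters over the product of the vertex groups *)

Definition vprod : groupType := prodg (@vgroup D).

Definition vin u : vprod := prodg_in (tagged u).

Lemma vinM u v : tag u = tag v -> vin (vmul u v) = vin u * vin v.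
Proof.
move=> /esym /in_v_tag; case: u => s g [h ->] /=.
by rewrite -/(in_v g) vmul_in /vin /= prodg_inM.
Qed.

Lemma vin_one s : vin (vone s) = 1.
Proof. exact: (morph1 (@prodg_inM _ _ s)). Qed.

Lemma vinV u : vin (vinv u) = (vin u)^-1.
Proof. by case: u => s g; exact: (morphV (@prodg_inM _ _ s)). Qed.

Lemma vin_inj u v : tag u = tag v -> vin u = vin v -> u = v.
Proof.
move=> /esym /in_v_tag; case: u => s g [h ->] /=.
by move=> eq_in; congr (in_v _); exact: (prodg_in_inj eq_in).
Qed.

Definition kphi e (x y : vprod) : Prop :=
  exists u v, [/\ phi e u v, vin u = x & vin v = y].

Lemma kphi1 e : kphi e 1 1.
Proof.
exists (vone (origin e)), (vone (terminus e)).
by rewrite !vin_one; split=> //; exact: phi_vone.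
Qed.

Lemma kphi_inj e y : kphi e 1 y -> y = 1.
Proof.
move=> [u [v [huv u1 <-]]]; have [tu _] := phi_tag huv.
have eu : u = vone (origin e) by apply: vin_inj; rewrite // u1 vin_one.
by rewrite (phi_inj (v := v) (v' := vone (terminus e)) huv) ?vin_one //
  eu; exact: phi_vone.
Qed.

Lemma kphi_div e x y x' y' : kphi e x y -> kphi e x' y' ->
  kphi e (x^-1 * x') (y^-1 * y').
Proof.
move=> [u [v [h <- <-]]] [u' [v' [h' <- <-]]].
exists (vmul (vinv u) u'), (vmul (vinv v) v').
have [tu tv] := phi_tag h; have [tu' tv'] := phi_tag h'.
rewrite !vinM ?vinV ?tag_vinv ?tu ?tv //.
by split=> //; apply: phiM => //; exact: phiV.
Qed.

Lemma kphi_opp e x y : kphi e x y -> kphi (eopp e) y x.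
Proof. by move=> [u [v [h <- <-]]]; exists v, u; split=> //; exact: phi_opp. Qed.

Definition ksys : stableSystem vprod (edge D) :=
  StableSystem (@eoppK D) (@eopp_neq D) kphi1 kphi_inj kphi_div kphi_opp.

(** The vertex of [u] matters: elements of different vertex groups have the same
    image in the product when they are trivial. *)
Lemma sdom_vin e u : tag u = origin e -> sdom ksys e (vin u) <-> vdom e u.
Proof.
move=> tu; split=> [[y [u' [v [h eu _]]]]|[v h]]; last first.
  by exists (vin v), u, v.
have [tu' _] := phi_tag h; exists v.
by rewrite -(@vin_inj u' u) // tu.
Qed.

(** ** The action *)

Lemma tree_path s s' :
  exists p, [/\ epath s p, eend s p = s' & all (mem T) p].
Proof.
have span := maximal_tree_spans (@gg_connected D) (@dgg_treeP D).
have [[[_ con] _] _] := @dgg_treeP D.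
exact: connect_epath (con _ _ (span s) (span s')).
Qed.

Definition base : vertex D :=
  xchoose (set0Pn _ (proj1 (@gg_connected D))).

Definition tpath s : seq (edge D) := xget [::]
  [set p | [/\ epath base p, eend base p = s & all (mem T) p]].

Lemma tpathP s :
  [/\ epath base (tpath s), eend base (tpath s) = s & all (mem T) (tpath s)].
Proof.
rewrite /tpath; case: xgetP => [p _ //|h].
by have [p hp] := tree_path base s; case: (h p).
Qed.

Notation W := (state vprod (edge D)).
Implicit Types w : W.
Notation ok := (sok ksys).
Notation walk := (steps (sstep ksys)).

Lemma walk_ok p w : ok w -> ok (walk w p).
Proof. by apply: steps_ok => a z; exact: sstep_ok. Qed.

Lemma walk_rev p w : ok w -> walk (walk w p) (erev p) = w.
Proof.
by apply: steps_rev => [a z|a z]; [exact: sstep_ok | exact: (@sstepK _ _ ksys)].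
Qed.

Lemma erevK (p : seq (edge D)) : erev (erev p) = p.
Proof.
rewrite /erev map_rev revK -map_comp -[RHS]map_id.
by apply: eq_map => a /=; rewrite eoppK.
Qed.

Lemma walk_revV p w : ok w -> walk (walk w (erev p)) p = w.
Proof. by move=> okw; rewrite -{2}[p]erevK walk_rev. Qed.

(** Vertex elements and stable letters act at the end of a normal form after
    it has been transported along the tree to the vertex where they live. *)
Definition pi1_act (w : W) (l : pi1_gen D * bool) : W :=
  match l with
  | (inl u, b) => walk (smul (walk w (tpath (tag u)))
                     (if b then vin u else (vin u)^-1)) (erev (tpath (tag u)))
  | (inr a, true) =>
      walk (sstep ksys a (walk w (tpath (origin a)))) (erev (tpath (terminus a)))
  | (inr a, false) =>
      walk (sstep ksys (eopp a) (walk w (tpath (terminus a))))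
        (erev (tpath (origin a)))
  end.

Lemma pi1_act_ok w l : ok w -> ok (pi1_act w l).
Proof.
by case: l => -[u|a] [] okw /=; apply: walk_ok;
  first [apply: sstep_ok | apply: smul_ok]; exact: walk_ok.
Qed.

Lemma smulK w x : smul (smul w x) x^-1 = w.
Proof. by case: w => s g; rewrite /smul /= mulgK. Qed.

Lemma smulVK w x : smul (smul w x^-1) x = w.
Proof. by case: w => s g; rewrite /smul /= mulgVK. Qed.

Lemma sstepVK e w : ok w -> sstep ksys e (sstep ksys (eopp e) w) = w.
Proof. by move=> okw; have := sstepK (eopp e) okw; rewrite /= eoppK. Qed.

Lemma pi1_act_inv w x b : ok w -> pi1_act (pi1_act w (x, b)) (x, ~~ b) = w.
Proof.
have h1 := walk_ok; case: x => [u|a]; case: b => okw /=.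
- rewrite walk_revV ?smulK ?walk_rev //; exact/smul_ok/walk_ok.
- rewrite walk_revV ?smulVK ?walk_rev //; exact/smul_ok/walk_ok.
- rewrite walk_revV; last exact/sstep_ok/walk_ok.
  rewrite (@sstepK _ _ ksys) ?walk_rev //; exact: walk_ok.
- rewrite walk_revV; last exact/sstep_ok/walk_ok.
  rewrite sstepVK ?walk_rev //; exact: walk_ok.
Qed.

(** Transport along the tree does not depend on the path, because closed paths in
    the tree act trivially. *)
Lemma tpath_step a w : a \in T -> ok w ->
  sstep ksys a (walk w (tpath (origin a))) = walk w (tpath (terminus a)).
Proof.
move=> aT okw; have [po eo To] := tpathP (origin a).
have [pt et Tt] := tpathP (terminus a).
have [[_ acyclic] _] := @dgg_treeP D.
set q := rcons (tpath (origin a)) a ++ erev (tpath (terminus a)).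
have hq : walk w q = w.
  have [h1 h2] := epath_rev pt; rewrite et in h1 h2.
  have e1 : eend base (rcons (tpath (origin a)) a) = terminus a.
    by rewrite -cats1 eend_cat.
  apply: (forest_closed_steps _ _ acyclic _ (s := base) _ _ okw).
  - by move=> e z; exact: sstep_ok.
  - by move=> e z; exact: (@sstepK _ _ ksys).
  - rewrite all_cat all_rcons To /= aT /= all_rev all_map.
    by apply/allP => b bp /=; apply: sub_edges_opp; exact: (allP Tt).
  - by rewrite epath_cat e1 h1 -cats1 epath_cat po eo /= eqxx.
  - by rewrite eend_cat e1.
have okq : ok (walk w (rcons (tpath (origin a)) a)) by exact: walk_ok.
rewrite -[in RHS]hq /q steps_cat walk_revV //.
by rewrite -cats1 steps_cat.
Qed.

Lemma pi1_act_rel (u v : word (pi1_gen D)) : pi1_rel u v ->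
  forall w, ok w -> foldl pi1_act w u = foldl pi1_act w v.
Proof.
have h1 := walk_ok; case=> {u v}.
- move=> s g h w okw /=; rewrite walk_revV; last exact/smul_ok/walk_ok.
  by rewrite -[in_v (g * h)]vmul_in vinM // /smul /= mulgA.
- move=> a h w okw /=; have hp := @phi_pos D a h.
  have okw1 := walk_ok (tpath (origin (val a))) okw.
  rewrite !walk_revV; try by do ![assumption | apply: sstep_ok | apply: walk_ok
    | apply: smul_ok].
  have hk : sphi ksys (val a) (vin (in_v (mono_o a h))) (vin (in_v (mono_e a h))).
    by exists (in_v (mono_o a h)), (in_v (mono_e a h)).
  by rewrite -(sstep_smul _ hk) (@sstepK _ _ ksys) //; exact: smul_ok.
- by move=> a w okw /=; rewrite -terminusE terminus_opp.
- move=> a aT w okw /=; rewrite tpath_step // walk_rev //.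
Qed.

Definition Act (w : W) (x : pi1 D) : W := pact pi1_act w x.

Lemma ActM x y w : ok w -> Act w (x * y) = Act (Act w x) y.
Proof. exact: (pactM pi1_act_ok pi1_act_inv pi1_act_rel). Qed.

Lemma Act_gen x w : ok w -> Act w (gen _ x) = pi1_act w (x, true).
Proof. by move=> okw; rewrite [LHS](pact_wclass pi1_act_ok pi1_act_inv pi1_act_rel). Qed.

Lemma Act_ok x w : ok w -> ok (Act w x).
Proof. exact: (pact_ok pi1_act_ok). Qed.

(** ** Uniqueness of reduced words *)

(** The word u_0 t_(e_1) u_1 .. t_(e_n) u_n is given by u_0 and by the list of the
    pairs (e_i, u_i); it runs from the vertex of u_0 to the end of e_n. *)
Notation gword := (seq (edge D * velt D)).
Implicit Types l : gword.

Fixpoint wpath s l : bool :=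
  if l is (e, u) :: l' then
    [&& origin e == s, tag u == terminus e & wpath (terminus e) l']
  else true.

Definition wend s l : vertex D := eend s (unzip1 l).

Definition wval l : pi1 D :=
  foldr (fun p x => stable p.1 * velt_pi1 p.2 * x) 1 l.

(** The word .. t_e u t_e' .. does not reduce at u: either e' is not the
    opposite of e, or u is outside the subgroup which crosses e'. *)
Definition nonback : rel (edge D * velt D) :=
  fun p q => ~~ ((q.1 == eopp p.1) && `[< vdom q.1 p.2 >]).

Definition reduced l : bool := sorted nonback l.

Definition kword l : seq (edge D * vprod) := [seq (p.1, vin p.2) | p <- l].

Lemma kword_reduced s l : wpath s l -> reduced l -> sreduced ksys (kword l).
Proof.
elim: l s => [|[e u] l ih] s //= /and3P[_ tu hl]; rewrite /reduced /= => hr.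
split; last by apply: ih hl _; case: l hr => //= p l /andP[].
case: l hl hr {ih} => [|[e' u'] l] //= /and3P[/eqP oe' _ _] /andP[/negP hn _].
move=> [/= ee hd]; apply: hn; rewrite /= ee eqxx /=; apply/asboolP.
by rewrite -ee; apply/sdom_vin; rewrite ?(eqP tu).
Qed.

(** The transports along the tree inserted by successive letters cancel. *)
Lemma Act_word s l w : wpath s l -> ok w ->
  Act (walk w (erev (tpath s))) (wval l) =
  walk (srun ksys w (kword l)) (erev (tpath (wend s l))).
Proof.
elim: l s w => [|[e u] l ih] s w /=.
  by move=> _ okw; apply: (pact1 pi1_act_ok pi1_act_inv pi1_act_rel); exact: walk_ok.
case/and3P=> /eqP <- /eqP tu hl okw.
have okw1 := walk_ok (erev (tpath (origin e))) okw.
rewrite ActM // ActM //; have okw2 := Act_ok (stable e) okw1.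
have -> : Act (walk w (erev (tpath (origin e)))) (stable e) =
    walk (sstep ksys e w) (erev (tpath (terminus e))).
  by rewrite Act_gen //= walk_revV.
rewrite Act_gen //=; last by apply: walk_ok; exact: sstep_ok.
rewrite tu walk_revV; last exact: sstep_ok.
rewrite ih //; last exact/smul_ok/sstep_ok.
Qed.

(** If the two words have the same value, they act in the same way on the empty
    normal form, and along reduced words the action only adds letters. *)
Theorem reduced_unique s (g g' : vgroup s) l l' :
  wpath s l -> wpath s l' -> wend s l = wend s l' -> reduced l -> reduced l' ->
  vgroup_pi1 g * wval l = vgroup_pi1 g' * wval l' ->
  unzip1 l = unzip1 l' /\
  if l is p :: _ then vdom p.1 (in_v (g^-1 * g')) else g = g'.
Proof.
move=> hl hl' el rl rl' eq_val.
have ok1 x : ok ([::], x) by [].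
have start (h : vgroup s) k : wpath s k ->
    Act (walk ([::], 1) (erev (tpath s))) (vgroup_pi1 h * wval k) =
    walk (srun ksys ([::], vin (in_v h)) (kword k)) (erev (tpath (wend s k))).
  move=> hk; rewrite ActM; last exact: walk_ok.
  rewrite Act_gen /=; last exact: walk_ok.
  by rewrite walk_revV // Act_word // /smul /= mul1g.
have okr x k : ok (srun ksys ([::], x) (kword k)).
  rewrite /srun; elim/last_ind: (kword k) => // k' p ih.
  by rewrite -cats1 foldl_cat; exact/smul_ok/sstep_ok.
have e : srun ksys ([::], vin (in_v g)) (kword l) =
         srun ksys ([::], vin (in_v g')) (kword l').
  have := start g l hl; rewrite eq_val start // -el.
  move=> /(congr1 (fun z => walk z (tpath (wend s l)))).
  by rewrite !walk_revV.
have [e1 e2] := srun_unique (kword_reduced hl rl) (kword_reduced hl' rl') e.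
split; first by move: e1; rewrite /kword /unzip1 -!map_comp.
case: l hl rl e2 {el eq_val e e1} => [|[e u] l] /= hl rl e2.
  by apply: in_v_inj; exact: vin_inj e2.
apply/sdom_vin; first by case/and3P: hl => /eqP.
have := vinM (u := in_v g^-1) (v := in_v g') erefl.
by rewrite vmul_in => ->; rewrite (vinV (in_v g)).
Qed.

(** The case of words without stable letters. *)
Lemma vgroup_pi1_inj s : injective (@vgroup_pi1 D s).
Proof.
move=> g g' h; have := @reduced_unique s g g' [::] [::].
by rewrite /= !mulg1 => /(_ isT isT erefl isT isT h)[].
Qed.

End GraphOfGroups.

(** * Central elements of the fundamental group *)

Section Centre.
Variable D : decomposedGraphOfGroups.
Notation T := (sub_edges (dgg_tree D)).
Notation gword := (seq (edge D * velt D)).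
Implicit Types (u v k : velt D) (a e f : edge D) (s : vertex D) (l : gword).
Implicit Types x y z : pi1 D.

Lemma wpath_cat s l l' : wpath s (l ++ l') = wpath s l && wpath (wend s l) l'.
Proof.
elim: l s => [|[e u] l ih] s //=.
by rewrite ih -!andbA.
Qed.

Lemma wend_cat s l l' : wend s (l ++ l') = wend (wend s l) l'.
Proof. by rewrite /wend /unzip1 map_cat eend_cat. Qed.

Lemma wval_cat l l' : wval (l ++ l') = wval l * wval l'.
Proof. by elim: l => [|p l ih] /=; rewrite ?mul1g // ih !mulgA. Qed.

(** ** Existence of words *)

(** [joins s s' n x]: the element [x] is the value of a path word with [n] edges
    from [s] to [s'].  In the action of the group on its Bass-Serre tree this
    bounds by [n] the distance between the base lift of [s] and the translate by
    [x] of the base lift of [s']. *)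
Definition joins s s' (n : nat) x : Prop :=
  exists (g : vgroup s) l,
    [/\ wpath s l, wend s l = s', size l = n & x = vgroup_pi1 g * wval l].

Lemma joins_velt u : joins (tag u) (tag u) 0 (velt_pi1 u).
Proof. by case: u => s g; exists g, [::]; rewrite /= mulg1. Qed.

Lemma joins_mull u s' n x : joins (tag u) s' n x ->
  joins (tag u) s' n (velt_pi1 u * x).
Proof.
case: u => s h /= [g [l [hl el sl ->]]]; exists (h * g), l; split=> //.
by rewrite vgroup_pi1M mulgA.
Qed.

Lemma joins_edge e s' n x : joins (terminus e) s' n x ->
  joins (origin e) s' n.+1 (stable e * x).
Proof.
case=> g [l [hl el sl ->]]; exists 1, ((e, in_v g) :: l).
split; rewrite /= ?eqxx ?sl ?vgroup_pi1_1 ?mul1g ?mulgA //.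
Qed.

Lemma joins_cat s s' s'' n m x y :
  joins s s' n x -> joins s' s'' m y -> joins s s'' (n + m) (x * y).
Proof.
move=> [g [l [hl <- <- ->]]] hy {n x s'}.
elim: l s g hl hy => [|[e u] l ih] s g /=.
  by move=> _ hy; rewrite mulg1; exact: (joins_mull (u := in_v g)).
case/and3P=> /eqP hs /eqP tu hl hy.
move: g; rewrite -hs => g.
have -> : vgroup_pi1 g * (stable e * velt_pi1 u * wval l) * y =
    velt_pi1 (in_v g) * (stable e * (velt_pi1 u * wval l * y)).
  by rewrite !mulgA.
apply: (joins_mull (u := in_v g)); apply: joins_edge.
by have [h ->] := in_v_tag tu; apply: ih.
Qed.

Lemma joins_word u l : wpath (tag u) l ->
  joins (tag u) (wend (tag u) l) (size l) (velt_pi1 u * wval l).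
Proof. by case: u => s g hl; exists g, l. Qed.

(** Edges of the tree have trivial stable letters. *)
Lemma joins_tree s s' : exists n, joins s s' n 1.
Proof.
have [p [hp <- pT]] := tree_path s s'; exists (size p).
elim: p s hp pT => [|a p ih] s /=.
  by have := joins_velt (vone s); rewrite velt_pi1_1.
case/andP=> /eqP <- hp /andP[aT pT].
by have := joins_edge (ih _ hp pT); rewrite stable_tree // mul1g.
Qed.

Lemma joins_total s x : exists n, joins s s n x.
Proof.
elim/pi1_ind: x; first exact: joins_tree.
- move=> x u [n hx]; have [m h1] := joins_tree s (tag u).
  have [m' h2] := joins_tree (tag u) s.
  eexists; have := joins_cat (joins_cat hx (joins_cat h1 (joins_velt u))) h2.
  by rewrite mul1g mulg1; apply.
- move=> x a [n hx]; have [m h1] := joins_tree s (origin a).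
  have [m' h2] := joins_tree (terminus a) s.
  eexists; have := joins_cat (joins_cat hx h1) (joins_edge h2).
  by rewrite !mulg1; apply.
Qed.

Lemma backtrack_shorter u l : wpath (tag u) l -> ~~ reduced l ->
  exists2 n, (n < size l)%N &
    joins (tag u) (wend (tag u) l) n (velt_pi1 u * wval l).
Proof.
move=> hl /not_sorted_split[l1 [[e v] [[e' v'] [l2 [el]]]]].
rewrite /nonback negbK /= => /andP[/eqP ee /asboolP[w hw]].
move: hl; rewrite {}el {}ee {e'} in hw *.
rewrite wpath_cat wend_cat /= => /andP[h1 /and5P[/eqP oe _ _ /eqP tv h2]].
exists (size l1 + (0 + size l2))%N; first by rewrite size_cat /=; lia.
have [_ tw] := phi_tag hw; rewrite terminus_opp in tw.
have -> : velt_pi1 u * wval (l1 ++ [:: (e, v), (eopp e, v') & l2]) =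
    velt_pi1 u * wval l1 * (velt_pi1 w * (velt_pi1 v' * wval l2)).
  rewrite wval_cat /= !mulgA; congr (_ * _ * _).
  rewrite -!mulgA; congr (_ * (_ * _)).
  by rewrite (phi_stable hw) stable_opp invgK !mulgA mulgV mul1g mulgK.
apply: joins_cat (joins_word h1) _; rewrite -oe -tw.
apply: joins_cat (joins_velt w) _; rewrite tw -[X in joins X](terminus_opp e) -tv.
rewrite /wend /eend /= -tv -/(eend _ _) -/(wend _ _).
by apply: joins_word; rewrite tv.
Qed.

(** ** Elliptic central elements *)

Hypothesis Dmin : minimal D.

(** Minimality gives an element of the end of [f] which does not cross [f]
    backwards, whatever the orientation of [f]. *)
Lemma minimal_proper f : f \in T ->
  exists k, tag k = terminus f /\ ~ vdom (eopp f) k.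
Proof.
move=> fT; have [fo|fno] := boolP (f \in orient D).
  have [_ [_ /existsNP[x /not_implyP[[g _ <-] hx]]]] := Dmin fT fo.
  exists (in_v g); split=> // -[v /phi_opp]; rewrite eoppK => hv; apply: hx.
  exists v, (in_v g); split=> //.
  by rewrite (phi_stable hv) stable_tree // invg1 mulg1 mul1g.
have fo : eopp f \in orient D by have := orientP f; rewrite (negbTE fno).
have [[_ /existsNP[x /not_implyP[[g _ <-] hx]]] _] := Dmin (sub_edges_opp fT) fo.
exists (in_v g); split; first by rewrite terminusE.
by case=> v hv; apply: hx; exists (in_v g), v.
Qed.

(** If [z] is in [G_(o f)] but not in [G_f], and [k] is in [G_(t f)] but not in
    [G_f], then the two sides of z (t_f k t_f^-1) = (t_f k t_f^-1) z are reduced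
    words which start with different cosets. *)
Lemma central_tree_edge z f : center (pi1 D) z -> f \in T ->
  Gv (origin f) z -> Gv (terminus f) z.
Proof.
move=> zc fT [g _ gz]; have [k [tk hk]] := minimal_proper fT.
have hk' : nonback (f, k) (eopp f, vone (origin f)).
  by rewrite /nonback /= eqxx /=; apply/asboolP.
have [||||||_ /=] := @reduced_unique D (origin f) g 1
  [:: (f, k); (eopp f, vone (origin f))] [:: (f, k); (eopp f, in_v g)].
- by rewrite /= -!terminusE terminus_opp tk !eqxx.
- by rewrite /= -!terminusE terminus_opp tk !eqxx.
- by [].
- by rewrite /reduced /= hk'.
- by rewrite /reduced /= andbT; exact: hk'.
- rewrite /= vgroup_pi1_1 mul1g velt_pi1_1 !mulg1 stable_opp.
  have := zc (stable f * velt_pi1 k * (stable f)^-1); rewrite /commute -gz.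
  by rewrite !mulgA.
rewrite mulg1 => /vdomV; rewrite /vinv /= invgK => -[v hv].
have [_ tv] := phi_tag hv; have [h ev] := in_v_tag tv.
exists h => //; rewrite -gz -[vgroup_pi1 h]/(velt_pi1 (in_v h)) -ev.
have := phi_stable hv; rewrite stable_tree // invg1 mulg1 mul1g => <-.
by [].
Qed.

Lemma central_Gv_all z s0 s : center (pi1 D) z -> Gv s0 z -> Gv s z.
Proof.
move=> zc; have [p [hp <- pT]] := tree_path s0 s.
elim: p s0 hp pT => [|a p ih] s0 //= /andP[/eqP <- hp] /andP[aT pT] hz.
by apply: (ih (terminus a)) => //; exact: central_tree_edge.
Qed.

(** Once [z] lies in all vertex groups, an edge [e] gives two words for
    z t_e = t_e z with coefficients z t_e 1 and 1 t_e z, so that their leading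
    coefficients differ by an element of the edge group. *)
Lemma elliptic_central z s0 : center (pi1 D) z -> Gv s0 z ->
  (forall s, Zv s z) /\ (forall e, e \notin T -> Fix e z).
Proof.
move=> zc hz; have hzs s : Gv s z by exact: central_Gv_all zc hz.
split=> [s|e _].
  have [g _ gz] := hzs s; exists g => //= h; apply: vgroup_pi1_inj.
  by rewrite !vgroup_pi1M gz zc.
have [g _ gz] := hzs (origin e); have [h _ hz'] := hzs (terminus e).
have [||||||_ /=] := @reduced_unique D (origin e) g 1
  [:: (e, vone (terminus e))] [:: (e, in_v h)] => //.
- by rewrite /= !eqxx.
- by rewrite /= !eqxx.
- rewrite /= velt_pi1_1 vgroup_pi1_1 mul1g !mulg1 gz.
  by rewrite -[velt_pi1 (in_v h)]/(vgroup_pi1 h) hz' zc.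
rewrite mulg1 => /vdomV; rewrite /vinv /= invgK => -[v hv].
exists (in_v g), v; split=> //; have := phi_stable hv.
rewrite -[velt_pi1 (in_v g)]/(vgroup_pi1 g) gz => ez.
have := zc (stable e); rewrite /commute {1}ez mulgVK => /mulgI ->.
by [].
Qed.

(** ** Hyperbolic central elements *)

(* A central element [z] and a nonempty closed path word for it, from [e1] to [en],
   which is shortest among the closed path words for [z] at all vertices. *)
Section Hyperbolic.
Variables (z : pi1 D) (s : vertex D) (g : vgroup s) (l : gword).
Variables (e1 en : edge D) (u1 un : velt D) (lt li : gword).
Hypotheses (zc : center (pi1 D) z) (hl : wpath s l) (el : wend s l = s).
Hypotheses (hz : z = vgroup_pi1 g * wval l).
Hypothesis zmin : forall s' m, joins s' s' m z -> (size l <= m)%N.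
Hypotheses (l_first : l = (e1, u1) :: lt) (l_last : l = rcons li (en, un)).

Lemma min_reduced : reduced l.
Proof.
apply/negPn/negP => /(@backtrack_shorter (in_v g) _ hl)[n hn].
rewrite /= el -[velt_pi1 _]/(vgroup_pi1 g) -hz => /zmin.
by rewrite leqNgt hn.
Qed.

Lemma origin_first : origin e1 = s.
Proof. by move: hl; rewrite l_first => /= /and3P[/eqP]. Qed.

Lemma terminus_last : terminus en = s.
Proof.
by move: el; rewrite l_last /wend /eend /unzip1 !map_rcons last_rcons.
Qed.

Lemma tag_last : tag un = s.
Proof.
move: hl; rewrite l_last -cats1 wpath_cat /= => /and3P[_ _ /andP[/eqP ->]].
by rewrite terminus_last.
Qed.

Lemma last_mul k : tag k = s -> exists h : vgroup s, vmul un (in_v h) = k.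
Proof.
move=> /in_v_tag[b ->]; have [a ->] := in_v_tag tag_last.
by exists (a^-1 * b); rewrite vmul_in mulVKg.
Qed.

(** The word for z h followed by [l2]: [h] is absorbed in the last coefficient. *)
Definition follow (h : vgroup s) (l2 : gword) : gword :=
  rcons li (en, vmul un (in_v h)) ++ l2.

Lemma followP h l2 : wpath s l2 -> reduced l2 ->
  (if l2 is p :: _ then nonback (en, vmul un (in_v h)) p else true) ->
  [/\ wpath s (follow h l2), wend s (follow h l2) = wend s l2,
      reduced (follow h l2), unzip1 (follow h l2) = unzip1 l ++ unzip1 l2 &
      vgroup_pi1 g * wval (follow h l2) = z * vgroup_pi1 h * wval l2].
Proof.
move=> h2 r2 hnb; have e_unzip : unzip1 (rcons li (en, vmul un (in_v h))) = unzip1 l.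
  by rewrite l_last /unzip1 !map_rcons.
have e_end : wend s (rcons li (en, vmul un (in_v h))) = s.
  by rewrite -[RHS]el /wend e_unzip.
split.
- rewrite wpath_cat e_end h2 andbT; move: hl.
  by rewrite l_last -!cats1 !wpath_cat.
- by rewrite wend_cat e_end.
- have := min_reduced; rewrite /follow l_last /reduced.
  case: (li) => [|p li'] /=.
    by move=> _; case: l2 h2 r2 hnb => [|q l2] //= _ r2 ->.
  rewrite cat_path !rcons_path /= last_rcons => /andP[-> hnb'] /=.
  rewrite [nonback _ _]hnb' /=.
  by case: l2 h2 r2 hnb => [|q l2] //= _ r2 ->.
- by rewrite /follow /unzip1 map_cat -/(unzip1 _) e_unzip.
rewrite hz l_last /follow -!cats1 !wval_cat /= !mulg1 velt_pi1M ?tag_last //.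
by rewrite !mulgA.
Qed.

(** The words h z and z h are both reduced, so that their leading coefficients
    h g and g are in the same coset of the edge group; here [h] is arbitrary. *)
Lemma first_vdom k : tag k = s -> vdom e1 k.
Proof.
case/in_v_tag=> b ->; set h := g * b^-1 * g^-1.
have [//|//|//|p1 p2 p3 _ p5] := followP (h := h) (l2 := [::]).
have [||||||_] := @reduced_unique D s (h * g) g l (follow h [::]) => //.
- by rewrite el p2.
- exact: min_reduced.
- by rewrite p5 /= mulg1 vgroup_pi1M -mulgA -hz zc.
rewrite l_first /= /h invgM; rewrite !invgM !invgK -!mulgA mulVg mulg1.
by rewrite mulKg.
Qed.

(** If [f] is in the tree, it is not [e1] by [first_vdom].  Choose [h] and [k']
    such that z h t_f k' t_f^-1 and h t_f k' t_f^-1 z are reduced: the first one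
    starts with [e1] and the second one with [f]. *)
Lemma no_tree_edge f : origin f = s -> f \notin T.
Proof.
move=> of_; apply/negP => fT.
have [k' [tk' hk']] := minimal_proper fT.
have [k [tk hk]] := minimal_proper (sub_edges_opp fT).
rewrite eoppK terminus_opp of_ in tk hk.
have ne : e1 <> f by move=> ef; apply: hk; rewrite -ef; exact: first_vdom.
have [h eh] := last_mul tk.
have hk1 w : nonback (f, k') (eopp f, w).
  by rewrite /nonback /= eqxx /=; apply/asboolP.
have tf : terminus (eopp f) = s by rewrite terminus_opp.
have of' : origin (eopp f) = terminus f by rewrite -terminusE.
have [|||p1 p2 p3 p4 p5] :=
  followP (h := h) (l2 := [:: (f, k'); (eopp f, vone s)]).
- by rewrite /= of_ tk' of' tf !eqxx.
- by rewrite /reduced /= hk1.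
- rewrite /nonback /= eh negb_and; apply/orP; right; exact/asboolP.
have [||||||] := @reduced_unique D s g h (follow h [:: (f, k'); (eopp f, vone s)])
  ((f, k') :: (eopp f, in_v g) :: l) => //.
- by rewrite /= of_ tk' of' tf !eqxx.
- by rewrite p2; apply: (etrans tf); rewrite -[LHS]el -{1}tf.
- have := min_reduced; rewrite /reduced /= hk1 l_first /= => ->.
  rewrite andbT /nonback /= eoppK negb_and; apply/orP; left; exact/eqP.
- rewrite p5 /= velt_pi1_1 !mulg1 stable_opp.
  rewrite -[velt_pi1 (in_v g)]/(vgroup_pi1 g) -!mulgA -hz.
  by rewrite zc !mulgA.
by rewrite p4 l_first /= => -[].
Qed.

Lemma single_vertex s' : s' = s.
Proof.
have [[|a p] [hp <- pT]] := tree_path s s'; first by [].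
move: hp pT => /= /andP[/eqP /no_tree_edge aT _].
by rewrite (negbTE aT).
Qed.

(** Otherwise conjugation of [z], which fixes it, by g t_(e1) would give a word
    with two letters less, based at the end of [e1]. *)
Lemma last_not_inverse : en <> eopp e1.
Proof.
move=> een; have := l_first; rewrite l_last.
case/lastP: lt => [|l2 p] e_l.
  have [e2 _] : en = e1 /\ un = u1.
    by move: e_l; case: (li) => [|q [|q' li']] //= [-> ->].
  by have := eopp_neq e1; rewrite -een e2 eqxx.
move: e_l; rewrite -rcons_cons => /rcons_inj[e_li e_p].
have := hl; rewrite l_last -cats1 wpath_cat e_li /= => /and3P[/and3P[_ /eqP tu1 h2]].
rewrite /wend /= -/(wend _ _) => /eqP oen _.
have [w hw] : vdom e1 (vmul un (in_v g)) by apply: first_vdom; exact: tag_last.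
have [_ tw] := phi_tag hw.
have j1 : joins (terminus e1) (terminus e1) (size l2) (velt_pi1 u1 * wval l2).
  have := @joins_word u1 l2; rewrite tu1 => /(_ h2).
  have -> : wend (terminus e1) l2 = terminus e1.
    by rewrite [RHS]terminusE -een oen.
  by [].
have j2 : joins (terminus e1) (terminus e1) 0 (velt_pi1 w).
  by have := joins_velt w; rewrite tw.
have := joins_cat j1 j2; rewrite addn0.
have -> : velt_pi1 u1 * wval l2 * velt_pi1 w = z.
  have [c ec] : exists c, c = vgroup_pi1 g * stable e1 by eexists.
  have ez : z = c * (velt_pi1 u1 * wval l2 * (stable en * velt_pi1 un)).
    by rewrite hz l_last -cats1 wval_cat e_li /= mulg1 ec !mulgA.
  have := zc c; rewrite /commute {1}ez -mulgA => /mulgI <-.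
  rewrite -[RHS]mulgA; congr (_ * _); rewrite een stable_opp ec.
  have := phi_stable hw; rewrite velt_pi1M ?tag_last //.
  rewrite -[velt_pi1 (in_v g)]/(vgroup_pi1 g) => e_w.
  rewrite -mulgA (mulgA (velt_pi1 un)) e_w.
  by rewrite !mulgA mulVg mul1g mulgVK.
move/zmin; rewrite l_last size_rcons e_li /=; lia.
Qed.

(** Under these conditions z t_f and t_f z are both reduced; the first one starts
    with [e1] and the second one with [f]. *)
Lemma edges_first f : f <> eopp en -> f <> eopp e1 -> f = e1.
Proof.
move=> nen ne1; have tf : terminus f = s by exact: single_vertex.
have of_ : origin f = s by exact: single_vertex.
have [|||p1 p2 p3 p4 p5] := followP (h := 1) (l2 := [:: (f, vone s)]).
- by rewrite /= of_ tf !eqxx.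
- by [].
- by rewrite /nonback /= negb_and; apply/orP; left; apply/eqP.
have [||||||] := @reduced_unique D s g 1 (follow 1 [:: (f, vone s)])
  ((f, in_v g) :: l) => //.
- by rewrite /= of_ tf !eqxx.
- by rewrite p2 !(single_vertex (wend _ _)).
- have := min_reduced; rewrite /reduced l_first /= => ->.
  rewrite andbT /nonback /= negb_and; apply/orP; left; apply/eqP => e.
  by apply: ne1; rewrite e eoppK.
- rewrite p5 /= velt_pi1_1 !mulg1 vgroup_pi1_1 mulg1 mul1g.
  rewrite -[velt_pi1 (in_v g)]/(vgroup_pi1 g) -!mulgA -hz.
  by rewrite zc.
by rewrite p4 l_first /= => -[].
Qed.

Lemma last_first : en = e1.
Proof.
apply: edges_first; last exact: last_not_inverse.
by move=> e; have := eopp_neq en; rewrite -e eqxx.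
Qed.

Lemma edges_pair f : f = e1 \/ f = eopp e1.
Proof.
have [h|h] := EM (f = eopp e1); [by right | left].
by apply: edges_first; rewrite ?last_first.
Qed.

(** Otherwise z h t_(e_1)^-1 is reduced for some [h], while h t_(e_1)^-1 z is not. *)
Lemma first_opp_vdom k : vdom (eopp e1) k.
Proof.
apply: contrapT => hk; have [h eh] := last_mul (single_vertex (tag k)).
have [w hw] : vdom e1 (in_v g) by exact: first_vdom.
have te : terminus e1 = s by exact: single_vertex.
have [|||p1 p2 p3 p4 p5] := followP (h := h) (l2 := [:: (eopp e1, vone s)]).
- by rewrite /= terminus_opp origin_first -terminusE te !eqxx.
- by [].
- by rewrite /nonback /= eh negb_and; apply/orP; right; apply/asboolP.
have tag_s v : exists b : vgroup s, v = in_v b.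
  exact: in_v_tag (single_vertex _).
have [b1 eb1] := tag_s u1; have [bw ebw] := tag_s w.
have [||||||e_unzip _] := @reduced_unique D s g (h * bw * b1)
  (follow h [:: (eopp e1, vone s)]) lt => //.
- by move: hl; rewrite l_first /= te => /and3P[].
- by rewrite !(single_vertex (wend _ _)).
- by have := min_reduced; rewrite l_first; exact: path_sorted.
- rewrite p5 /= velt_pi1_1 !mulg1 stable_opp -mulgA zc hz l_first /=.
  rewrite !vgroup_pi1M -[vgroup_pi1 bw]/(velt_pi1 (in_v bw)).
  rewrite -[vgroup_pi1 b1]/(velt_pi1 (in_v b1)) -ebw -eb1.
  have := phi_stable hw; rewrite -[velt_pi1 (in_v g)]/(vgroup_pi1 g) => ->.
  by rewrite !mulgA mulgVK mulgVK.
have := congr1 size e_unzip; rewrite p4 l_first size_cat /= /unzip1 !size_map.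
lia.
Qed.

End Hyperbolic.

(** Geometrically, the Bass-Serre tree is the axis of [z], and elements which
    commute with the translation [z] cannot exchange the two ends of the axis. *)
Lemma hyperbolic_central z : center (pi1 D) z -> ~ (exists s, Gv s z) ->
  exists s e, [/\ forall s', s' = s, forall f, f = e \/ f = eopp e &
                  forall k, vdom e k /\ vdom (eopp e) k].
Proof.
move=> zc nz.
have ex_n : exists n, `[< exists s, joins s s n z >].
  have [n hn] := joins_total (base D) z.
  by exists n; apply/asboolP; exists (base D).
case: (ex_minnP ex_n) => n /asboolP[s [g [l [hl el sl hz]]]] nmin.
have zmin s' m : joins s' s' m z -> (size l <= m)%N.
  by move=> hj; rewrite sl; apply: nmin; apply/asboolP; exists s'.
case l_first : {1}l => [|[e1 u1] lt].
  by case: nz; exists s, g; rewrite // hz l_first mulg1.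
case/lastP l_last : {1}l => [|li [en un]]; first by rewrite l_last in l_first.
exists s, e1; split=> [s'|f|k].
- exact: (single_vertex zc hl el hz zmin l_first l_last).
- exact: (edges_pair zc hl el hz zmin l_first l_last).
split; last exact: (first_opp_vdom zc hl el hz zmin l_first l_last).
apply: (first_vdom zc hl el hz zmin l_first l_last).
exact: (single_vertex zc hl el hz zmin l_first l_last).
Qed.

End Centre.

(** * Integer powers *)

Section IntegerPowers.
Variable G : groupType.
Implicit Types (x y : G) (m p : int).

Lemma expgzS x m : expgz x (m + 1)%R = expgz x m * x.
Proof.
case: m => [n|[|n]].
- by rewrite -PoszD addn1 /= expgSr.
- by rewrite /= expg1 mulVg.
- have -> : (Negz n.+1 + 1)%R = Negz n by lia.
  by rewrite /= [x ^+ n.+2]expgS invgM mulgVK.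
Qed.

Lemma expgzP x m : expgz x (m - 1)%R = expgz x m * x^-1.
Proof. by have := expgzS x (m - 1)%R; rewrite GRing.subrK => ->; rewrite mulgK. Qed.

Lemma expgzN x m : expgz x (- m)%R = (expgz x m)^-1.
Proof.
case: m => [[|n]|n]; first by rewrite GRing.oppr0 /= invg1.
  by have -> : (- Posz n.+1)%R = Negz n by lia.
have -> : (- Negz n)%R = Posz n.+1 by lia.
by rewrite /= invgK.
Qed.

Lemma expgzM x (n : nat) p : expgz x (p * n%:Z)%R = expgz (x ^+ n) p.
Proof.
have pos q : expgz x (Posz q * n%:Z)%R = expgz (x ^+ n) (Posz q).
  by rewrite -PoszM /= mulnC expgnA.
by case: p => q //; rewrite NegzE GRing.mulNr !expgzN pos.
Qed.

Lemma commute_expgz x y p : commute x y -> commute x (expgz y p).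
Proof. by case: p => n h /=; [|apply: commuteV]; apply: commuteX. Qed.

Lemma expgzMn x y p : commute x y -> expgz (x * y) p = expgz x p * expgz y p.
Proof.
move=> xy; case: p => n /=; rewrite expgMn // invgM.
by rewrite (commuteV (commute_sym (commuteV (commuteX2 n.+1 n.+1 xy)))).
Qed.

End IntegerPowers.

Lemma morph_expgz (G H : groupType) (f : G -> H) p :
  {morph f : x y / x * y} -> {morph f : x / expgz x p}.
Proof.
move=> fM x; have fX n : f (x ^+ n) = f x ^+ n.
  by elim: n => [|n ih]; [exact: morph1 | rewrite !expgS fM ih].
by case: p => n /=; rewrite ?(morphV fM) fX.
Qed.

(** * A single loop *)

Section KernelCentral.
Variable D : decomposedGraphOfGroups.
Notation T := (sub_edges (dgg_tree D)).

(** z = t_e phi_e(z) t_e^-1 = t_e z t_e^-1. *)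
Lemma Fix_commute (e : edge D) z : Fix e z -> commute z (stable e).
Proof.
by case=> u [v [/phi_stable + uz vz]]; rewrite uz vz /commute => {1}->; rewrite mulgVK.
Qed.

Lemma kernel_central (z : pi1 D) : (forall s, Zv s z) ->
  (forall e, e \notin T -> Fix e z) -> center (pi1 D) z.
Proof.
move=> hv hF; apply: pi1_center => [[s h]|e].
  have [c cc <-] := hv s; rewrite /commute -[velt_pi1 _]/(vgroup_pi1 h).
  by rewrite -!vgroup_pi1M cc.
have [eT|eT] := boolP (e \in T); last exact: Fix_commute (hF e eT).
by rewrite stable_tree //; exact: commute1.
Qed.

Lemma Fix_opp (e : edge D) z : Fix e z -> Fix (eopp e) z.
Proof. by case=> u [v [/phi_opp h uz vz]]; exists v, u. Qed.

End KernelCentral.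

Section SingleLoop.
Variables (D : decomposedGraphOfGroups) (s : vertex D) (a : edge D).
Hypothesis loop : single_loop s a.
Notation T := (sub_edges (dgg_tree D)).
Notation vg := (@vgroup_pi1 D s).
Notation t := (stable a).

Lemma loop_vertex s' : s' = s. Proof. by case: loop. Qed.
Lemma loop_edge e : e = a \/ e = eopp a. Proof. by case: loop. Qed.

Lemma loop_notin_tree : a \notin T.
Proof.
have [[_ acyclic] _] := @dgg_treeP D; have := acyclic [:: a].
rewrite /circuit /= (loop_vertex (terminus a)) -(loop_vertex (origin a)) eqxx.
by rewrite eq_sym eopp_neq !andbT => /(_ isT).
Qed.

Lemma loop_notin_tree_all e : e \notin T.
Proof.
case: (loop_edge e) => ->; first exact: loop_notin_tree.
by apply: contra loop_notin_tree => /sub_edges_opp; rewrite eoppK.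
Qed.

Definition to_s (u : velt D) : vgroup s := etagged (loop_vertex (tag u)).

Lemma to_sK u : in_v (to_s u) = u.
Proof. exact: etaggedK. Qed.

Lemma in_vK h : to_s (in_v h) = h.
Proof. by apply: in_v_inj; rewrite to_sK. Qed.

Lemma vg_to_s u : vg (to_s u) = velt_pi1 u.
Proof. by rewrite /vgroup_pi1 to_sK. Qed.

(** ** The fundamental group is the HNN extension *)

Notation loop_phi := (fun g g' : vgroup s => phi a (in_v g) (in_v g')).
Notation HNN_loop := (HNN loop_phi).

Definition HNN_to_pi1 : HNN_loop -> pi1 D :=
  pres_lift (fun x => match x with inl g => vg g | inr _ => t end).

Definition pi1_to_HNN : pi1 D -> HNN_loop :=
  pres_lift (fun x => match x with
    | inl u => HNN_base _ (to_s u)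
    | inr e => if e == a then HNN_stable _ else (HNN_stable _)^-1
    end).

Lemma HNN_to_pi1_rel u v : HNN_rel loop_phi u v ->
  foldl (letter_val (fun x => match x with inl g => vg g | inr _ => t end)) 1 u =
  foldl (letter_val (fun x => match x with inl g => vg g | inr _ => t end)) 1 v.
Proof.
case=> [g h|h h' hp]; rewrite /letter_val /= !mul1g; first exact: vgroup_pi1M.
rewrite -[vg h]/(velt_pi1 (in_v h)) (phi_stable hp).
by rewrite !mulgA mulVg mul1g mulgVK.
Qed.

Lemma HNN_baseM : {morph @HNN_base _ loop_phi : g h / g * h}.
Proof.
move=> g h; apply: (etrans _ (wclass_cat _ _ _)).
by apply/wclassP; apply: pres_rel; exact: HNN_rel_mul.
Qed.

Lemma HNN_stable_rel h h' : loop_phi h h' ->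
  HNN_base loop_phi h =
  HNN_stable loop_phi * HNN_base loop_phi h' * (HNN_stable loop_phi)^-1.
Proof.
move=> hp; have -> : HNN_base loop_phi h' =
    (HNN_stable loop_phi)^-1 * HNN_base loop_phi h * HNN_stable loop_phi.
  rewrite /HNN_stable -wclass_inv.
  apply: (etrans (y := wclass (HNN_rel loop_phi)
    ([:: (inr tt, false)] ++ [:: (inl h, true)] ++ [:: (inr tt, true)]))).
    by apply/wclassP; apply: pres_sym; apply: pres_rel; exact: HNN_rel_stable.
  by rewrite !wclass_cat mulgA.
by rewrite !mulgA mulgV mul1g mulgK.
Qed.

Lemma pi1_to_HNN_rel u v : pi1_rel u v ->
  foldl (letter_val (fun x => match x with
    | inl u => HNN_base loop_phi (to_s u)
    | inr e => if e == a then HNN_stable _ else (HNN_stable _)^-1 end)) 1 u =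
  foldl (letter_val (fun x => match x with
    | inl u => HNN_base loop_phi (to_s u)
    | inr e => if e == a then HNN_stable _ else (HNN_stable _)^-1 end)) 1 v.
Proof.
case=> [s' g h|e h|e|e eT]; rewrite /letter_val /= ?mul1g.
- rewrite -HNN_baseM; congr (HNN_base _ _); apply: in_v_inj.
  by rewrite -[RHS]vmul_in !to_sK vmul_in.
- have ea : val e = a.
    case: (loop_edge (val e)) => // ee; have := orientP a.
    have -> : eopp a \in orient D by rewrite -ee; exact: (valP e).
    by case: loop => ->.
  have hp : phi a (in_v (mono_o e h)) (in_v (mono_e e h)).
    by rewrite -{1}ea; exact: phi_pos.
  have -> : (sval e == a) = true by apply/eqP.
  by apply: HNN_stable_rel; rewrite !to_sK.
- case: (loop_edge e) => ->; first by rewrite (negbTE (eopp_neq a)) eqxx.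
  by rewrite eoppK eqxx (negbTE (eopp_neq a)) invgK.
- by have := loop_notin_tree_all e; rewrite eT.
Qed.

Lemma HNN_to_pi1M : {morph HNN_to_pi1 : x y / x * y}.
Proof. exact: pres_liftM HNN_to_pi1_rel. Qed.

Lemma pi1_to_HNNM : {morph pi1_to_HNN : x y / x * y}.
Proof. exact: pres_liftM pi1_to_HNN_rel. Qed.

Lemma HNN_to_pi1K : cancel HNN_to_pi1 pi1_to_HNN.
Proof.
apply: (presented_morph_ext (f := pi1_to_HNN \o HNN_to_pi1) (g := id)) => //.
  by move=> x y /=; rewrite HNN_to_pi1M pi1_to_HNNM.
move=> x /=; rewrite /HNN_to_pi1 (pres_lift_gen HNN_to_pi1_rel).
case: x => [g|[]]; rewrite /pi1_to_HNN (pres_lift_gen pi1_to_HNN_rel).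
  by rewrite in_vK.
by rewrite eqxx.
Qed.

Lemma pi1_to_HNNK : cancel pi1_to_HNN HNN_to_pi1.
Proof.
apply: (presented_morph_ext (f := HNN_to_pi1 \o pi1_to_HNN) (g := id)) => //.
  by move=> x y /=; rewrite pi1_to_HNNM HNN_to_pi1M.
move=> x /=; rewrite /pi1_to_HNN (pres_lift_gen pi1_to_HNN_rel).
case: x => [u|e].
  by rewrite /HNN_to_pi1 (pres_lift_gen HNN_to_pi1_rel) vg_to_s.
have h : HNN_to_pi1 (HNN_stable _) = t by exact: (pres_lift_gen HNN_to_pi1_rel).
case: (loop_edge e) => ->; first by rewrite eqxx h.
by rewrite (negbTE (eopp_neq a)) (morphV HNN_to_pi1M) h -stable_opp.
Qed.

Lemma loop_is_HNN : pi1_is_HNN s a.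
Proof.
pose m := isMultiplicative.Build HNN_loop (pi1 D) HNN_to_pi1 HNN_to_pi1M.
pose theta : {multiplicative HNN_loop -> pi1 D} := HB.pack HNN_to_pi1 m.
exists theta; split.
- by exists pi1_to_HNN; [exact: HNN_to_pi1K | exact: pi1_to_HNNK].
- by move=> g; exact: (pres_lift_gen HNN_to_pi1_rel).
- exact: (pres_lift_gen HNN_to_pi1_rel).
Qed.

(** ** The centre *)

Hypothesis Dmin : minimal D.

Lemma loop_kernel_central z : (Zv s `&` Fix a) z -> center (pi1 D) z.
Proof.
move=> [zs zF]; apply: kernel_central => [s'|e _].
  by rewrite (loop_vertex s').
by case: (loop_edge e) => -> //; exact: Fix_opp.
Qed.

Lemma loop_elliptic z : center (pi1 D) z -> Gv s z -> (Zv s `&` Fix a) z.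
Proof.
move=> zc zs; have [h1 h2] := elliptic_central Dmin zc zs.
by split; [exact: h1 | exact: (h2 _ loop_notin_tree)].
Qed.

Lemma loop_proper_center : Gminus a `<` Gv s \/ Gplus a `<` Gv s ->
  center (pi1 D) = Zv s `&` Fix a.
Proof.
move=> hp; apply/seteqP; split=> z; last exact: loop_kernel_central.
move=> zc; apply: loop_elliptic => //; apply: contrapT => nz.
have [|s' [e [_ _ hdom]]] := hyperbolic_central Dmin zc.
  by case=> s'; rewrite (loop_vertex s').
have {hdom} [h1 h2] : (forall k, vdom a k) /\ (forall k, vdom (eopp a) k).
  case: (loop_edge e) hdom => -> hdom; first by split=> k; case: (hdom k).
  by split=> k; case: (hdom k) => //; rewrite eoppK.
case: hp => -[_ /existsNP[x /not_implyP[[g _ <-] hx]]]; apply: hx.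
  by have [v hv] := h1 (in_v g); exists (in_v g), v.
by have [v /phi_opp] := h2 (in_v g); rewrite eoppK => hv; exists v, (in_v g).
Qed.

Section FullLoop.
Hypotheses (full_minus : Gminus a = Gv s) (full_plus : Gplus a = Gv s).
Notation vphi := (phi_map s a).

Lemma phi_mapP h : phi a (in_v h) (in_v (vphi h)).
Proof.
have : Gv s (vg h) by exists h.
rewrite -full_minus => -[u [v [huv eu]]]; have eh : to_s u = h.
  by apply: vgroup_pi1_inj; rewrite vg_to_s.
rewrite /phi_map; case: xgetP => [x _ //|/(_ (to_s v))] /=.
by rewrite to_sK -eh to_sK.
Qed.

Lemma phi_map_surj h : exists h', vphi h' = h.
Proof.
have : Gv s (vg h) by exists h.
rewrite -full_plus => -[u [v [huv ev]]]; have eh : to_s v = h.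
  by apply: vgroup_pi1_inj; rewrite vg_to_s.
exists (to_s u); rewrite -eh; apply: in_v_inj.
by apply: phi_inj (phi_mapP _) _; rewrite !to_sK.
Qed.

Lemma stable_vg h : vg h * t = t * vg (vphi h).
Proof.
have := phi_stable (phi_mapP h); rewrite -[velt_pi1 (in_v h)]/(vg h) => ->.
by rewrite mulgVK.
Qed.

Lemma stableX_vg n h : vg h * t ^+ n = t ^+ n * vg (iter n vphi h).
Proof.
elim: n => [|n ih]; first by rewrite mulg1 mul1g.
by rewrite expgSr mulgA ih -mulgA stable_vg iterS mulgA.
Qed.

(** The vertex group is normal, with cyclic quotient generated by t. *)
Lemma loop_normal_form x : exists m g, x = expgz t m * vg g.
Proof.
elim/pi1_ind: x => [|x u [m [g ->]]|x e [m [g ->]]].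
- by exists 0%R, 1; rewrite vgroup_pi1_1 mulg1.
- by exists m, (g * to_s u); rewrite vgroup_pi1M vg_to_s mulgA.
case: (loop_edge e) => ->.
  by exists (m + 1)%R, (vphi g); rewrite expgzS -!mulgA stable_vg.
have [h eh] := phi_map_surj g; exists (m - 1)%R, h; rewrite -eh expgzP stable_opp.
rewrite -!mulgA; congr (_ * _); apply: (@mulgI _ t); apply: (@mulIg _ t).
by rewrite !mulgA mulgVK mulgV mul1g stable_vg.
Qed.

Lemma central_pos n g : center (pi1 D) (t ^+ n * vg g) ->
  forall h, iter n vphi h = g * h * g^-1.
Proof.
move=> zc h; apply: (@mulIg _ g); rewrite mulgVK; apply: vgroup_pi1_inj.
rewrite !vgroup_pi1M; apply: (@mulgI _ (t ^+ n)).
by rewrite !mulgA -stableX_vg -[LHS]mulgA; exact/esym/zc.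
Qed.

Lemma central_neg n g : center (pi1 D) (t ^- n * vg g) ->
  forall h, iter n vphi h = g^-1 * h * g.
Proof.
move=> zc h; apply: vgroup_pi1_inj; apply: (@mulgI _ (t ^+ n)).
rewrite -stableX_vg.
have := zc (vg (g^-1 * h * g)); rewrite /commute -[LHS]mulgA -vgroup_pi1M.
rewrite !mulgA mulgV mul1g [vg (h * g)]vgroup_pi1M !mulgA => /mulIg e.
by apply: (@mulgI _ (t ^- n)); rewrite mulKg mulgA e mulgVK.
Qed.

Lemma loop_central_vgroup m g : center (pi1 D) (expgz t m * vg g) ->
  Fix a (vg g).
Proof.
move=> zc; exists (in_v g), (in_v (vphi g)); split=> //; first exact: phi_mapP.
rewrite -[LHS]/(vg (vphi g)); apply: (@mulgI _ t); rewrite -stable_vg.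
have := zc t; rewrite /commute mulgA.
rewrite (commute_expgz m (commute_refl t)) -!mulgA => /mulgI.
by [].
Qed.

Lemma loop_infinite_center : Out_order_infinite vphi ->
  center (pi1 D) = Zv s `&` Fix a.
Proof.
move=> inf; apply/seteqP; split=> z; last exact: loop_kernel_central.
move=> zc; have [m [g ez]] := loop_normal_form z; apply: loop_elliptic => //.
move: zc; rewrite {}ez; case: m => [[|n]|n] /= zc.
- by exists g => //; rewrite mul1g.
- by case: (inf n.+1 isT); exists g; exact: central_pos.
- by case: (inf n.+1 isT); exists g^-1 => h; rewrite invgK; exact: central_neg.
Qed.

Section FiniteOrder.
Variables (n : nat) (g0 : vgroup s).
Hypothesis ord_n : Out_order vphi n.
Hypothesis inner_n : forall g, iter n vphi g = g0 * g * g0^-1.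

Lemma iter_mul_order q h : iter (q * n) vphi h = g0 ^+ q * h * g0 ^- q.
Proof.
elim: q => [|q ih]; first by rewrite mul1g invg1 mulg1.
by rewrite mulSn iterD ih inner_n expgS invgM !mulgA.
Qed.

(** Division of [k] by the order: the remainder also gives an inner
    automorphism, hence vanishes. *)
Lemma inner_iter k x : (forall h, iter k vphi h = x * h * x^-1) ->
  exists q c, [/\ k = (q * n)%N, center (vgroup s) c & x = g0 ^+ q * c].
Proof.
move=> hk; have [n0 _ nmin] := ord_n.
set q := (k %/ n)%N; set y := x * g0 ^- q.
have hr h : iter (k %% n) vphi h = y * h * y^-1.
  have := hk (g0 ^- q * h * g0 ^+ q).
  rewrite {1}(divn_eq k n) addnC iterD iter_mul_order -/q.
  by rewrite !mulgA mulgV mul1g mulgK => ->; rewrite /y invgM invgK !mulgA.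
have r0 : (k %% n = 0)%N.
  have [->//|rn0] := posnP (k %% n)%N.
  by case: (nmin (k %% n)%N); [rewrite rn0 ltn_mod | exists y].
exists q, (g0 ^- q * x); split; last by rewrite mulVKg.
  by rewrite {1}(divn_eq k n) r0 addn0.
move=> h; have := hk h; rewrite {1}(divn_eq k n) r0 addn0 iter_mul_order -/q.
move=> e; rewrite /commute -mulgA; apply: (@mulgI _ (g0 ^+ q)).
by rewrite mulVKg !mulgA e mulgVK.
Qed.

Lemma stable_order_commute h : commute (t ^+ n * vg g0) (vg h).
Proof.
by rewrite /commute mulgA stableX_vg inner_n -!mulgA -!vgroup_pi1M mulgA mulgVK.
Qed.

(** Commuting with the vertex group, t^n g_0 commutes with g_0, hence so does t^n. *)
Lemma stable_order_power p :
  expgz t (p * n%:Z)%R * vg (expgz g0 p) = expgz (t ^+ n * vg g0) p.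
Proof.
rewrite expgzM (morph_expgz _ (@vgroup_pi1M D s)) expgzMn //.
apply: commute_sym; have := stable_order_commute g0.
by move=> /commute_sym; rewrite /commute !mulgA => /mulIg.
Qed.

Lemma loop_finite_center : center (pi1 D) =
  \bigcup_(p : int) [set expgz t (p * n%:Z)%R * x
    | x in Fix a `&` [set vg (expgz g0 p * z) | z in center (vgroup s)]].
Proof.
apply/seteqP; split=> z.
  (* The exponent of t is a multiple of n by [inner_iter], applied to g if it is
     nonnegative and to the inverse of g otherwise. *)
  move=> zc; have [m [g ez]] := loop_normal_form z.
  rewrite {z}ez in zc *; have hF := loop_central_vgroup zc.
  case: m zc => k zc.
    have [q [c [-> cc eg]]] := inner_iter (central_pos zc).
    exists (Posz q) => //; exists (vg g); last by rewrite -PoszM.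
    by split=> //; exists c; rewrite // eg.
  have hk h : iter k.+1 vphi h = g^-1 * h * (g^-1)^-1.
    by rewrite invgK; exact: central_neg zc h.
  have [q [c [ek cc eg]]] := inner_iter hk.
  exists (- Posz q)%R => //; exists (vg g).
    split=> //; exists c^-1 => [h|]; first exact/commute_sym/commuteV/commute_sym.
    rewrite expgzN /= -[g in RHS]invgK eg invgM; congr vg.
    exact/commuteV/commute_sym/cc.
  by rewrite GRing.mulNr expgzN -PoszM -ek.
(* (t^n g_0)^p commutes with the vertex group, and so does the remaining factor;
   t commutes with its own powers and with the elements of Fix a. *)
case=> p _ [x [xF [c cc ex]] <-]; rewrite -{x}ex in xF *.
have xz : expgz t (p * n%:Z)%R * vg (expgz g0 p * c) =
    expgz (t ^+ n * vg g0) p * vg c.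
  by rewrite vgroup_pi1M mulgA stable_order_power.
apply: pi1_center => [u|e].
  rewrite xz -vg_to_s; apply: commute_sym; apply: commuteM.
    by apply: commute_expgz; apply: commute_sym; exact: stable_order_commute.
  by rewrite /commute -!vgroup_pi1M cc.
have ht : commute (expgz t (p * n%:Z)%R * vg (expgz g0 p * c)) t.
  apply: commute_sym; apply: commuteM.
    by apply: commute_expgz; exact: commute_refl.
  by apply: commute_sym; exact: Fix_commute.
by case: (loop_edge e) => ->; rewrite ?stable_opp //; exact: commuteV.
Qed.

End FiniteOrder.
End FullLoop.
End SingleLoop.

Theorem mainTheorem1 (D : decomposedGraphOfGroups) (Dmin : minimal D) :
  (exists (s : vertex D) (a : edge D),
    [/\ single_loop s a,
        pi1_is_HNN s a,
        Gminus a `<` Gv s \/ Gplus a `<` Gv s ->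
          center (pi1 D) = Zv s `&` Fix a,
        Gminus a = Gv s -> Gplus a = Gv s ->
        Out_order_infinite (phi_map s a) ->
          center (pi1 D) = Zv s `&` Fix a
      & Gminus a = Gv s -> Gplus a = Gv s ->
        forall n : nat, Out_order (phi_map s a) n ->
        forall g0 : vgroup s,
          (forall g : vgroup s, iter n (phi_map s a) g = g0 * g * g0^-1) ->
          center (pi1 D) =
            \bigcup_(p : int)
              [set expgz (stable a) (p * n%:Z)%R * x
                 | x in Fix a `&`
                        [set vgroup_pi1 (expgz g0 p * z)
                           | z in center (vgroup s)]]])
  \/
  (~ (exists (s : vertex D) (a : edge D), single_loop s a) /\
   center (pi1 D) =
     (\bigcap_(s : vertex D) Zv s) `&`
     (\bigcap_(a in [set a : edge D | a \notin sub_edges (dgg_tree D)]) Fix a)).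
Proof.
have [[s [a loop]]|noloop] := EM (exists (s : vertex D) (a : edge D), single_loop s a).
  left; exists s, a; split=> //.
  - exact: loop_is_HNN.
  - exact: loop_proper_center.
  - by move=> fm fp; exact: loop_infinite_center.
  - by move=> fm fp n ord_n g0 inner_n; exact: loop_finite_center.
right; split=> //; apply/seteqP; split=> z; last first.
  by move=> [zs zF]; apply: kernel_central => [s|e eT]; [exact: zs | exact: zF].
move=> zc; have [[s zs]|hyp] := EM (exists s, Gv s z).
  have [h1 h2] := elliptic_central Dmin zc zs.
  by split=> [s' _|e /= eT]; [exact: h1 | exact: h2].
have [s [e [h1 h2 _]]] := hyperbolic_central Dmin zc hyp.
case: noloop; exists s; have := orientP e.
have [eo _|neo /= eo] := boolP (e \in orient D); first by exists e.
exists (eopp e); split=> // b; rewrite eoppK.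
by case: (h2 b); [right | left].
Qed.
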